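(* Let $G$ be a connected graph with maximum degree at most $3$ and girth at least $5$ that is not isomorphic to $H_1$ or $H_2$. Then $$\nu_{ur}(G) \geq \frac{n(G)-1}{3},$$ where $n(G)$ is the number of vertices of $G$.
   Context: A matching $M$ in a graph $G$ is uniquely restricted if no other matching in $G$ covers the same set of vertices; $\nu_{ur}(G)$ denotes the maximum size of a uniquely restricted matching in $G$. Girth at least $5$ means $G$ has no cycle of length $3$ or $4$. The graphs $H_1$ and $H_2$ are defined as follows. Let $G_1$ be the graph with vertices $a_1,a_2,a_3,a_4$ and $s_{ij}$ for $1\le i<j\le 4$, and edges $a_is_{ij}$ and $a_js_{ij}$ for all $1\le i<j\le 4$ (the graph obtained from $K_4$ by subdividing every edge once). Let $G_2$ arise from $G_1$ by adding new vertices $t_1,t_2,t_3$ with $t_1$ adjacent to $s_{14},s_{23}$, $t_2$ adjacent to $s_{24},s_{13}$, and $t_3$ adjacent to $s_{12},s_{34}$. Then $H_1$ arises from $G_2$ by adding a new vertex $x$ adjacent to $t_1,t_2,t_3$ (a cubic graph on $14$ vertices). Let $G_3$ be the graph with vertices $z$, $w_0,w_2,w_4$, $b_0,\dots,b_5$, $c_0,\dots,c_5$ and edges $b_ib_{i+1}$ and $c_ic_{i+1}$ for $i=0,\dots,5$ (indices mod $6$), $zw_j$, $w_jb_j$, $w_jc_j$ for $j\in\{0,2,4\}$. Let $G_4$ arise from $G_3$ by adding new vertices $w_1,w_3,w_5$ with $w_j$ adjacent to $b_j$ and $c_j$ for $j\in\{1,3,5\}$. Then $H_2$ arises from $G_4$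 by adding a new vertex $x$ adjacent to $w_1,w_3,w_5$ (a cubic graph on $20$ vertices). *)

(* Defs.v *)
(* Simple graphs are symmetric irreflexive relations on a finType. *)
From mathcomp Require Import all_boot.
Set Implicit Arguments. Unset Strict Implicit. Unset Printing Implicit Defensive.

Section Graphs.
Variable T : finType.
Variable e : rel T.

Definition is_matching (M : {set {set T}}) : bool :=
  [forall m in M, exists x, exists y, e x y && (m == [set x; y])] &&
  [forall m1 in M, forall m2 in M, (m1 != m2) ==> [disjoint m1 & m2]].

Definition uniquely_restricted (M : {set {set T}}) : bool :=
  is_matching M &&
  [forall M' : {set {set T}}, (is_matching M' && (cover M' == cover M)) ==> (M' == M)].

Definition nu_ur : nat := \max_(M : {set {set T}} | uniquely_restricted M) #|M|.

Definition connected_graph : Prop := forall x y : T, connect e x y.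

Definition max_degree_le (k : nat) : Prop := forall x : T, #|[set y | e x y]| <= k.

Definition girth_ge5 : Prop :=
  (forall x y z : T, ~ [/\ e x y, e y z & e z x]) /\
  (forall x y z w : T, x != z -> y != w -> ~ [/\ e x y, e y z, e z w & e w x]).
End Graphs.

Definition graph_iso (T T' : finType) (e : rel T) (e' : rel T') : Prop :=
  exists f : T -> T', bijective f /\ forall x y, e x y = e' (f x) (f y).

Definition rel_of_edges (n : nat) (l : seq (nat * nat)) : rel 'I_n :=
  fun i j => ((nat_of_ord i, nat_of_ord j) \in l) || ((nat_of_ord j, nat_of_ord i) \in l).
Arguments rel_of_edges : clear implicits.

(* H1: a1..a4 = 0..3; s12,s13,s14,s23,s24,s34 = 4..9; t1,t2,t3 = 10,11,12; x = 13 *)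
Definition H1_edges : seq (nat * nat) :=
  [:: (0,4); (1,4); (0,5); (2,5); (0,6); (3,6); (1,7); (2,7); (1,8); (3,8); (2,9); (3,9);
      (10,6); (10,7); (11,8); (11,5); (12,4); (12,9); (13,10); (13,11); (13,12)].
Definition H1 : rel 'I_14 := rel_of_edges 14 H1_edges.

(* H2: z = 0; w_j = 1+j (j=0..5); b_i = 7+i; c_i = 13+i (i=0..5); x = 19 *)
Definition H2_edges : seq (nat * nat) :=
  [:: (7,8); (8,9); (9,10); (10,11); (11,12); (12,7);
      (13,14); (14,15); (15,16); (16,17); (17,18); (18,13);
      (0,1); (0,3); (0,5);
      (1,7); (1,13); (3,9); (3,15); (5,11); (5,17);
      (2,8); (2,14); (4,10); (4,16); (6,12); (6,18);
      (19,2); (19,4); (19,6)].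
Definition H2 : rel 'I_20 := rel_of_edges 20 H2_edges.

(* Main.v *)
(* For a vertex set S let f(S) = |S| - 3 nu(S), where nu(S) is the uniquely
   restricted matching number of the subgraph induced by S. Two matchings can be
   combined when all edges between them share a vertex; in particular f is
   subadditive over components, and matching u to a neighbour while discarding
   the rest of its neighbourhood costs deg(u) + 1 vertices.

   By induction, a connected noncubic graph has f <= 1, and it is bad (f = 1) only
   if it is a single vertex, or three bad graphs joined by one edge each to a new
   vertex, or bridgeless and one of nine explicit graphs. For a bridge, a bad side
   behaves like a pendant vertex. In a bridgeless bad graph no bad part other than
   a single vertex is attached by just two edges. Deleting the closed
   neighbourhood of a vertex of degree 2 therefore leaves a connected bad graph,
   so the graph arises from a smaller bridgeless one, or from a claw, by attaching
   a path on three vertices or a hexagon: a finite check.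
   A bridgeless cubic graph with f >= 2 must be one of the nine graphs plus a vertex
   of degree 3, and the finite check leaves only H_1 and H_2. *)

(* The bound is proved for noncubic graphs because this class survives deletions: if [D] is removed
   from a connected subcubic graph, every component left has a vertex that lost a neighbour. All
   deletion steps are one count ([delete_bound]): f of the remainder is at most its number of bad
   components, and in a k-edge-connected graph each of these uses up k of the few edges at [D]. The
   obstacle is a bad part attached by only two edges, which this count tolerates. To exclude it, the
   induction carries a further property, [deletable2]: a bridgeless bad graph loses nothing when two
   vertices of degree at most 2 are removed, so an attaching vertex can be matched across the cut
   for free. The computations rest on lower bounds for nu, certified by peeling; the listed
   exceptions are identified by isomorphism. *)
Require Import Defs.
From mathcomp Require Import all_boot.
From mathcomp Require Import zify ring.
Set Implicit Arguments. Unset Strict Implicit. Unset Printing Implicit Defensive.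

(** * Small explicit graphs *)

(* Entry [i] lists the neighbours of vertex [i] among the vertices [j < i];
   adding a vertex is [rcons]. *)
Definition lgraph := seq (seq nat).

Definition adj (g : lgraph) (i j : nat) : bool :=
  (j \in nth [::] g i) || (i \in nth [::] g j).

Definition nbrs (g : lgraph) : lgraph :=
  [seq [seq j <- iota 0 (size g) | adj g i j] | i <- iota 0 (size g)].

(* Maximum degree at most 3 and girth at least 5. *)
Definition sparse (g : lgraph) : bool :=
  let a := nbrs g in
  all (fun l => size l <= 3) a &&
  all (fun i => all (fun j => (i == j) ||
    (size [seq k <- nth [::] a i | k \in nth [::] a j] + (j \in nth [::] a i) <= 1))
    (iota 0 (size g))) (iota 0 (size g)).

Definition clear (m : bitseq) (l : seq nat) : bitseq :=
  foldr (fun j m' => set_nth false m' j false) m l.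

(* One step matches [u] to a neighbour and discards all other neighbours of [u]; the
   edge lies on no alternating cycle. A leaf is always worth matching first,
   so it is taken without branching. [find p l < size l] replaces [has p l],
   and [if] replaces [&&] and [||], because the latter are strict under call by
   value. *)
Fixpoint greedy (a : lgraph) (k : nat) (m : bitseq) : bool :=
  if k is k'.+1 then
    let deg u := if nth false m u then count (nth false m) (nth [::] a u) else 0 in
    let peel u := greedy a k' (clear m (u :: nth [::] a u)) in
    let degs := [seq deg u | u <- iota 0 (size m)] in
    if 1 \in degs then peel (index 1 degs)
    else let d := if 2 \in degs then 2 else 3 in
      find (fun u => if nth 0 degs u == d then peel u else false) (iota 0 (size m)) < size m
  else true.

(** Branching only on vertices of least positive degree is a heuristic; if it fails, the first step
    may peel any non-isolated vertex. *)
Definition greedy_size (g : lgraph) (k : nat) : bool :=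
  let a := nbrs g in
  let m := nseq (size g) true in
  if greedy a k m then true
  else find (fun u => if nth [::] a u is _ :: _ then
                        greedy a k.-1 (clear m (u :: nth [::] a u)) else false)
            (iota 0 (size g)) < size g.

Fixpoint first_some (A : Type) (f : nat -> option A) (s : seq nat) : option A :=
  if s is c :: s' then (if f c is Some r then Some r else first_some f s') else None.

(** Backtracking in the vertex order of [h]: an entry [nb] lists all earlier neighbours, so [c] is
    compared with the vertices already placed. The answer is a certificate that [is_iso] rechecks,
    and soundness rests on that check alone. *)
Fixpoint embed (a : lgraph) (h : lgraph) (l : seq nat) : option (seq nat) :=
  if h is nb :: h' then
    first_some (fun c =>
      if c \in l then None else
      if all (fun j => (nth 0 l j \in nth [::] a c) == (j \in nb)) (iota 0 (size l))
      then embed a h' (rcons l c) else None) (iota 0 (size a))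
  else Some l.

Definition is_iso (g h : lgraph) (l : seq nat) : bool :=
  let n := size g in
  [&& size h == n, size l == n, uniq l, all (fun i => i < n) l &
    all (fun i => all (fun j => adj g (nth 0 l i) (nth 0 l j) == adj h i j) (iota 0 n))
      (iota 0 n)].

(** Comparing degree sums (with the [shape] of nested lists) avoids the search when the numbers of
    edges differ. *)
Definition find_iso (g h : lgraph) : bool :=
  if sumn (shape (nbrs g)) == sumn (shape (nbrs h)) then
    if embed (nbrs g) h [::] is Some l then is_iso g h l else false
  else false.

(* Path u, v, w with middle vertex u, whose ends v and w are attached to [i; j] and
   [k; l]; numbered v, w, u so that every new vertex has an earlier neighbour. *)
Definition ext_path (g : lgraph) (i j k l : nat) : lgraph :=
  let n := size g in g ++ [:: [:: i; j]; [:: k; l]; [:: n; n.+1]].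
(* A hexagon with alternate vertices attached to [i], [j], [k]. *)
Definition ext_hex (g : lgraph) (i j k : nat) : lgraph :=
  let n := size g in
  g ++ [:: [:: i]; [:: j]; [:: k]; [:: n; n.+1]; [:: n; n.+2]; [:: n.+1; n.+2]].

(* [B1], ..., [B4] are the graphs G_1, ..., G_4; the other five complete the closure
   under [ext_path] and [ext_hex], up to isomorphism and up to graphs with
   3 nu_ur >= n. [B1] also arises from a claw. *)
Definition K13 : lgraph := [:: [::]; [:: 0]; [:: 0]; [:: 0]].
Definition B1 := ext_hex K13 1 2 3.
Definition B2 := ext_path B1 1 9 2 8.
Definition B3 := ext_hex B1 1 2 3.
Definition B4 := ext_path B3 7 13 8 14.
Definition B5 := ext_path B3 7 14 8 13.
Definition B6 := ext_hex B2 3 7 12.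
Definition B7 := ext_path B2 3 3 7 12.
Definition B8 := ext_hex B4 9 15 18.
Definition B9 := ext_path B4 9 9 15 18.
Definition blocks := [:: B1; B2; B3; B4; B5; B6; B7; B8; B9].

(** The number tested is n / 3 rounded up, so success means 3 nu_ur >= n. *)
Definition large (g : lgraph) : bool := greedy_size g ((size g).+2 %/ 3).

Definition open_ends (g : lgraph) : seq nat :=
  [seq i <- iota 0 (size g) | size (nth [::] (nbrs g) i) <= 2].

(** A graph that is not sparse passes because it cannot occur as an induced subgraph
    ([realizes_sparse]). *)
Definition ext_ok (known : bool) (g : lgraph) : bool :=
  if sparse g then
    if known then has (find_iso g) blocks else large g
  else true.

(** The order conditions use the symmetries of the attached path: exchange the two attachments of an
    end, or exchange the ends. The cases [i = j] and [k = l] are kept: a repeated index stands for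
    an end with a single neighbour in [g]. *)
Definition path_ok (p : lgraph * seq (seq nat)) : bool :=
  let: (g, known) := p in
  let I := open_ends g in
  all (fun i => all (fun j => all (fun k => all (fun l =>
    if [&& i <= j, i <= k & k <= l] then
      ext_ok ([:: i; j; k; l] \in known) (ext_path g i j k l)
    else true) I) I) I) I.

(** The symmetries of a hexagon permute three alternate vertices arbitrarily, so sorted triples
    suffice. *)
Definition hex_ok (p : lgraph * seq (seq nat)) : bool :=
  let: (g, known) := p in
  let I := open_ends g in
  all (fun i => all (fun j => all (fun k =>
    if i <= j <= k then ext_ok ([:: i; j; k] \in known) (ext_hex g i j k)
    else true) I) I) I.

(* The lists give the attachments, found by computer search, for which the
   extension is again a block; all other sparse extensions have 3 nu_ur >= n. *)
Definition hex_table : seq (lgraph * seq (seq nat)) :=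
  [:: (K13, [:: [:: 1; 2; 3]]);
      (B1, [:: [:: 1; 2; 3]; [:: 1; 7; 8]; [:: 2; 7; 9]; [:: 3; 8; 9]]);
      (B2, [:: [:: 3; 7; 12]]); (B3, [::]); (B4, [:: [:: 9; 15; 18]]);
      (B5, [::]); (B6, [::]); (B7, [::]); (B8, [::]); (B9, [::])].

(** No claw here: the path is attached only to bridgeless bad graphs, the hexagon also to a claw. *)
Definition path_table : seq (lgraph * seq (seq nat)) :=
  [:: (B1, [:: [:: 1; 9; 2; 8]; [:: 1; 9; 3; 7]; [:: 2; 8; 3; 7]]);
      (B2, [:: [:: 3; 3; 7; 12]; [:: 3; 7; 12; 12]; [:: 3; 12; 7; 7]]);
      (B3, [:: [:: 7; 13; 8; 14]; [:: 7; 13; 9; 15]; [:: 7; 14; 8; 13];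
               [:: 7; 15; 9; 13]; [:: 8; 14; 9; 15]; [:: 8; 15; 9; 14]]);
      (B4, [:: [:: 9; 9; 15; 18]; [:: 9; 15; 18; 18]; [:: 9; 18; 15; 15]]);
      (B5, [::]); (B6, [::]); (B7, [::]); (B8, [::]); (B9, [::])].

Definition edge_graph (n : nat) (l : seq (nat * nat)) : lgraph :=
  [seq [seq j <- iota 0 i | ((i, j) \in l) || ((j, i) \in l)] | i <- iota 0 n].

Definition edge_graph_ok (n : nat) (l : seq (nat * nat)) : bool :=
  all (fun i => all (fun j =>
    adj (edge_graph n l) i j == (((i, j) \in l) || ((j, i) \in l))) (iota 0 n)) (iota 0 n).

(* Adding one vertex of degree 3 yields H_1, H_2, or a graph with
   3 nu_ur >= n - 1. *)
Definition claw_ok (p : lgraph * seq (seq nat)) : bool :=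
  let: (g, known) := p in
  let I := open_ends g in
  all (fun i => all (fun j => all (fun k =>
    if i < j < k then
      let h := rcons g [:: i; j; k] in
      if sparse h then
        if [:: i; j; k] \in known then
          find_iso (edge_graph 14 H1_edges) h || find_iso (edge_graph 20 H2_edges) h
        else greedy_size h ((size h).+1 %/ 3)
      else true
    else true) I) I) I.

(** The two triples are the vertices of degree 2 in G_2 and G_4, to which the vertex x of H_1 and
    H_2 is joined. *)
Definition claw_table : seq (lgraph * seq (seq nat)) :=
  [:: (B1, [::]); (B2, [:: [:: 3; 7; 12]]); (B3, [::]); (B4, [:: [:: 9; 15; 18]]);
      (B5, [::]); (B6, [::]); (B7, [::]); (B8, [::]); (B9, [::])].

Lemma hex_table_ok : all hex_ok hex_table. Proof. vm_cast_no_check (erefl true). Qed.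
Lemma path_table_ok : all path_ok path_table. Proof. vm_cast_no_check (erefl true). Qed.
Lemma claw_table_ok : all claw_ok claw_table. Proof. vm_cast_no_check (erefl true). Qed.
Lemma H1_graph_ok : edge_graph_ok 14 H1_edges. Proof. vm_cast_no_check (erefl true). Qed.
Lemma H2_graph_ok : edge_graph_ok 20 H2_edges. Proof. vm_cast_no_check (erefl true). Qed.

Section SubcubicGraphs.
Variables (T : finType) (e : rel T) (x0 : T).
Hypotheses (e_sym : symmetric e) (e_irr : irreflexive e).
Hypotheses (Hdeg : max_degree_le e 3) (Hgirth : girth_ge5 e).
Implicit Types (M F : {set {set T}}) (A B C D G P S X : {set T}) (x y z : T).
Implicit Types (s : seq T) (g h : lgraph).

(** * Uniquely restricted matchings *)

Lemma matchingP M :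
  reflect ((forall m, m \in M -> exists x y, e x y /\ m = [set x; y]) /\ trivIset M)
          (is_matching e M).
Proof.
apply: (iffP andP) => [[/forall_inP H1 /forall_inP H2]|[H1 /trivIsetP H2]]; split.
- by move=> m /H1 /existsP[x /existsP[y /andP[exy /eqP->]]]; exists x, y.
- apply/trivIsetP => A B AM BM AB.
  by have /forall_inP /(_ _ BM) /implyP/(_ AB) := H2 _ AM.
- apply/forall_inP => m /H1[x [y [exy ->]]]; apply/existsP; exists x.
  by apply/existsP; exists y; rewrite exy eqxx.
- apply/forall_inP => A AM; apply/forall_inP => B BM; apply/implyP => AB.
  exact: H2.
Qed.

Lemma urP M :
  reflect (is_matching e M /\ forall M', is_matching e M' -> cover M' = cover M -> M' = M)
          (uniquely_restricted e M).
Proof.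
apply: (iffP andP) => [[-> /forallP H]|[-> H]]; split=> //.
  by move=> M' mM' cM'; move: (H M'); rewrite mM' cM' eqxx => /eqP.
by apply/forallP => M'; apply/implyP => /andP[mM' /eqP cM']; apply/eqP/H.
Qed.

Lemma matching_sub M M' : M' \subset M -> is_matching e M -> is_matching e M'.
Proof.
move=> sM /matchingP[H1 H2]; apply/matchingP; split; last exact: trivIsetS H2.
by move=> m /(subsetP sM)/H1.
Qed.

Lemma card_cover_matching M : is_matching e M -> #|cover M| = #|M| * 2.
Proof.
case/matchingP => H1 /eqP <-.
rewrite -sum_nat_const; apply: eq_bigr => m /H1[x [y [exy ->]]].
by rewrite cards2; case: eqP exy => // ->; rewrite e_irr.
Qed.

Lemma mem_cover M x : reflect (exists2 m, m \in M & x \in m) (x \in cover M).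
Proof. exact: bigcupP. Qed.

Lemma coverU M1 M2 : cover (M1 :|: M2) = cover M1 :|: cover M2.
Proof. by rewrite /cover bigcup_setU. Qed.

(* [M1] and [M2] cover evenly many vertices each, so a matching on the same
   vertices cannot use exactly one crossing edge; nor can it use two, since all
   of them contain [b]. *)
Lemma ur_union M1 M2 b :
  uniquely_restricted e M1 -> uniquely_restricted e M2 ->
  [disjoint cover M1 & cover M2] ->
  (forall x y, x \in cover M1 -> y \in cover M2 -> e x y || e y x -> (x == b) || (y == b)) ->
  uniquely_restricted e (M1 :|: M2).
Proof.
move=> /urP[m1 u1] /urP[m2 u2] dC cross.
have [e1 t1] := matchingP _ m1; have [e2 t2] := matchingP _ m2.
apply/urP; split.
  apply/matchingP; split=> [m|]; first by rewrite inE => /orP[/e1|/e2].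
  apply/trivIsetP => A B; rewrite !inE => /orP[AM|AM] /orP[BM|BM] AB.
  - exact: (trivIsetP t1).
  - by apply: (disjointWl _ (disjointWr _ dC)); apply: bigcup_sup.
  - by rewrite disjoint_sym; apply: (disjointWl _ (disjointWr _ dC)); apply: bigcup_sup.
  - exact: (trivIsetP t2).
move=> M' m' c'; rewrite coverU in c'.
have [e' t'] := matchingP _ m'.
pose X := [set m in M' | m \subset cover M1].
pose Y := [set m in M' | m \subset cover M2].
have XM : X \subset M' by apply/subsetP => m; rewrite inE => /andP[].
have YM : Y \subset M' by apply/subsetP => m; rewrite inE => /andP[].
have mX := matching_sub XM m'; have mY := matching_sub YM m'.
have sX : cover X \subset cover M1.
  by apply/bigcupsP => m; rewrite inE => /andP[].
have sY : cover Y \subset cover M2.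
  by apply/bigcupsP => m; rewrite inE => /andP[].
have cr m : m \in M' -> m \notin X -> m \notin Y ->
    exists x y, [/\ x \in cover M1, y \in cover M2, m = [set x; y] & b \in m].
  move=> mM; rewrite !inE mM /= => nX nY.
  have [x [y [exy em]]] := e' _ mM.
  have : m \subset cover M1 :|: cover M2 by rewrite -c'; apply: bigcup_sup.
  move: nX nY; rewrite em !subUset !sub1set !inE => nX nY /andP[/orP[xC|xC] /orP[yC|yC]].
  - by rewrite xC yC in nX.
  - exists x, y; split=> //; rewrite !(eq_sym b).
    by apply: cross; rewrite ?exy.
  - exists y, x; split=> //; first by rewrite setUC.
    by rewrite !(eq_sym b) orbC; apply: cross; rewrite ?exy ?orbT.
  - by rewrite xC yC in nY.
have [cX|ncX] := boolP (cover M1 \subset cover X); last first.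
  have /subsetPn[x xC1 xX] := ncX.
  have /mem_cover[m mM xm] : x \in cover M' by rewrite c' inE xC1.
  have mX' : m \notin X by apply: contra xX => mX'; apply/mem_cover; exists m.
  have mY' : m \notin Y.
    apply/negP => mY'; move: (disjointFr dC xC1).
    by rewrite (subsetP sY) //; apply/mem_cover; exists m.
  have [x' [y [x'C1 yC2 em bm]]] := cr m mM mX' mY'.
  have xx' : x = x'.
    move: xm; rewrite em !inE => /orP[/eqP//|/eqP xy].
    by move: (disjointFr dC xC1); rewrite xy yC2.
  (* The crossing edge through [x] is the only one, so [X] covers all of [cover M1] except [x], an
     odd number of vertices. *)
  have cXe : cover X = cover M1 :\ x.
    apply/eqP; rewrite eqEsubset; apply/andP; split.
      apply/subsetP => z zX; rewrite !inE (subsetP sX) // andbT.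
      by apply: contraNneq xX => <-.
    apply/subsetP => z; rewrite !inE => /andP[zx zC1].
    have /mem_cover[m2' m2M zm2] : z \in cover M' by rewrite c' inE zC1.
    have [m2X|m2X] := boolP (m2' \in X); first by apply/mem_cover; exists m2'.
    have m2Y : m2' \notin Y.
      apply/negP => mY2; move: (disjointFr dC zC1).
      by rewrite (subsetP sY) //; apply/mem_cover; exists m2'.
    have [x2 [y2 [x2C1 y2C2 em2 bm2]]] := cr m2' m2M m2X m2Y.
    have emm : m2' = m.
      apply: contraTeq bm => ne; rewrite (disjointFr _ bm2) //.
      exact: (trivIsetP t').
    move: zm2; rewrite emm em !inE -xx' (negbTE zx) /= => /eqP zy.
    by move: (disjointFr dC zC1); rewrite zy yC2.
  have := card_cover_matching mX; have := card_cover_matching m1.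
  rewrite (cardsD1 x (cover M1)) xC1 -cXe => H1 H2; move: H1; rewrite H2 => /(congr1 odd).
  by rewrite add1n oddS !muln2 !odd_double.
have XE : X = M1 by apply: u1 => //; apply/eqP; rewrite eqEsubset sX.
have noc m : m \in M' -> (m \in X) || (m \in Y).
  move=> mM; apply: contraT; rewrite negb_or => /andP[nX nY].
  have [x [y [xC1 yC2 em _]]] := cr m mM nX nY.
  have /mem_cover[m0 m0X xm0] := subsetP cX _ xC1.
  suff emm : m = m0 by rewrite emm m0X in nX.
  have xm : x \in m by rewrite em !inE eqxx.
  apply: contraTeq xm => ne; rewrite (disjointFl _ xm0) //.
  by apply: (trivIsetP t') => //; apply: (subsetP XM).
have YE : Y = M2.
  apply: u2 => //; apply/eqP; rewrite eqEsubset sY /=.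
  apply/subsetP => y yC2.
  have /mem_cover[m mM ym] : y \in cover M' by rewrite c' inE yC2 orbT.
  case/orP: (noc m mM) => [mX'|mY']; last by apply/mem_cover; exists m.
  have : y \in cover M1 by rewrite (subsetP sX) //; apply/mem_cover; exists m.
  by rewrite (disjointFl dC yC2).
rewrite -XE -YE; apply/setP => m; rewrite in_setU.
by apply/idP/orP => [/noc/orP//|[/(subsetP XM)|/(subsetP YM)]].
Qed.

(** Uniqueness is tested in the whole graph, but a competing matching covers the same vertices and
    hence stays inside [S]. So this is the parameter of the subgraph induced by [S], without a
    change of type. *)
Definition nu S := \max_(M | uniquely_restricted e M && (cover M \subset S)) #|M|.

Lemma nu_setT : nu setT = nu_ur e.
Proof. by apply: eq_bigl => M; rewrite subsetT andbT. Qed.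

Lemma ur_nu M S : uniquely_restricted e M -> cover M \subset S -> #|M| <= nu S.
Proof. by move=> uM cM; apply: leq_bigmax_cond; rewrite uM. Qed.

Lemma ur_set0 : uniquely_restricted e set0.
Proof.
have c0 : cover (set0 : {set {set T}}) = set0 by rewrite /cover big_set0.
apply/urP; split.
  by apply/matchingP; split=> [m|]; [rewrite inE | apply/trivIsetP => A; rewrite inE].
move=> M' mM' cM'; apply/eqP; rewrite -cards_eq0.
by have := card_cover_matching mM'; rewrite cM' c0 cards0; lia.
Qed.

Lemma nu_witness S :
  exists M, [/\ uniquely_restricted e M, cover M \subset S & #|M| = nu S].
Proof.
have h0 : uniquely_restricted e set0 && (cover set0 \subset S).
  by rewrite ur_set0 /cover big_set0 sub0set.
rewrite /nu (bigop.bigmax_eq_arg set0) //.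
by case: arg_maxnP => // M /andP[u c] _; exists M.
Qed.

Lemma nuS A B : A \subset B -> nu A <= nu B.
Proof.
move=> AB; have [M [uM cM <-]] := nu_witness A.
exact: ur_nu uM (subset_trans cM AB).
Qed.

Lemma nu_union A B b : [disjoint A & B] ->
  (forall x y, x \in A -> y \in B -> e x y -> (x == b) || (y == b)) ->
  nu A + nu B <= nu (A :|: B).
Proof.
move=> dAB cross.
have [M1 [u1 c1 <-]] := nu_witness A; have [M2 [u2 c2 <-]] := nu_witness B.
have dC : [disjoint cover M1 & cover M2].
  exact: disjointWl c1 (disjointWr c2 dAB).
have dM : [disjoint M1 & M2].
  rewrite -setI_eq0; apply/eqP/setP => m; rewrite !inE; apply/negP => /andP[mM1 mM2].
  have [e1 _] := matchingP _ (proj1 (urP _ u1)).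
  have [x [y [_ em]]] := e1 _ mM1.
  have xm : x \in m by rewrite em !inE eqxx.
  have xC1 : x \in cover M1 by apply/mem_cover; exists m.
  have xC2 : x \in cover M2 by apply/mem_cover; exists m.
  by rewrite (disjointFr dC xC1) in xC2.
have <- : #|M1 :|: M2| = #|M1| + #|M2|.
  by rewrite cardsU (disjoint_setI0 dM) cards0 subn0.
apply: ur_nu; last by rewrite coverU setUSS.
apply: (ur_union (b := b)) => // x y xC1 yC2; rewrite [e y x]e_sym orbb.
by apply: cross; [apply: (subsetP c1) | apply: (subsetP c2)].
Qed.

Lemma nu_edge u v : e u v -> 0 < nu [set u; v].
Proof.
move=> euv; pose M := [set [set u; v]].
have cM : cover M = [set u; v] by rewrite /cover big_set1.
have mM : is_matching e M.
  apply/matchingP; split=> [m|]; first by rewrite inE => /eqP ->; exists u, v.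
  by apply/trivIsetP => A B; rewrite !inE => /eqP-> /eqP->; rewrite eqxx.
suff uM : uniquely_restricted e M by rewrite -(cards1 [set u; v]) ur_nu // cM.
apply/urP; split=> // M' m' c'.
have := card_cover_matching m'; have := card_cover_matching mM.
rewrite -c' cards1 => -> M'1.
have /cards1P[m em] : #|M'| == 1 by lia.
by move: c'; rewrite em /cover !big_set1 => ->.
Qed.

(** With all neighbours of [u] removed, every edge between the remainder and the pair [u], [v]
    contains [v], so [nu_union] applies. *)
Lemma nu_peel S u v : u \in S -> v \in S -> e u v ->
  (nu (S :\: (u |: [set y | e u y]))).+1 <= nu S.
Proof.
move=> uS vS euv; rewrite -addn1.
set A := S :\: _.
have dA : [disjoint A & [set u; v]].
  rewrite disjoint_sym; rewrite disjoint_subset; apply/subsetP => z.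
  by rewrite !inE => /orP[]/eqP->; rewrite ?eqxx ?euv ?orbT.
apply: leq_trans (leq_trans (nu_union (b := v) dA _) (nuS (B := S) _)).
- by rewrite leq_add2l nu_edge.
- move=> x y; rewrite !inE negb_or -andbA => /and3P[xu nux _] /orP[/eqP->|->].
    by rewrite e_sym (negbTE nux).
  by rewrite orbT.
- by rewrite subUset subsetDl subUset !sub1set uS vS.
Qed.

(** * Edge counts and components *)

Definition dg S x := #|[set y in S | e x y]|.
(** Counts ordered pairs, hence edges between [A] and [B] when these are disjoint. *)
Definition eb A B := \sum_(x in A) dg B x.

Lemma dgE S x : dg S x = \sum_(y in S) e x y.
Proof.
rewrite /dg -sum1_card [RHS]big_mkcond [LHS]big_mkcond /=.
by apply: eq_bigr => y _; rewrite inE; case: (y \in S); case: (e x y).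
Qed.

Lemma ebC A B : eb A B = eb B A.
Proof.
rewrite /eb (eq_bigr (fun x => \sum_(y in B) e x y)) => [|x _]; last exact: dgE.
rewrite exchange_big /=; apply: eq_bigr => y _; rewrite dgE.
by apply: eq_bigr => x _; rewrite e_sym.
Qed.

Lemma ebUl A B C : [disjoint A & B] -> eb (A :|: B) C = eb A C + eb B C.
Proof.
move=> dAB; rewrite /eb -bigU //; apply: eq_bigl => x.
by rewrite !inE.
Qed.

Lemma ebUr A B C : [disjoint B & C] -> eb A (B :|: C) = eb A B + eb A C.
Proof. by move=> dBC; rewrite ebC ebUl // !(ebC A). Qed.

Lemma eb_set1l x B : eb [set x] B = dg B x. Proof. by rewrite /eb big_set1. Qed.
Lemma eb_set1r A x : eb A [set x] = dg A x. Proof. by rewrite ebC eb_set1l. Qed.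

Lemma ebSl A B C : A \subset B -> eb A C <= eb B C.
Proof.
move=> AB; rewrite -(setID B A) (setIidPr AB) ebUl ?leq_addr //.
by rewrite disjoint_sym; apply/setDidPl; rewrite setDDl setUid.
Qed.

Lemma ebSr A B C : B \subset C -> eb A B <= eb A C.
Proof. by move=> BC; rewrite !(ebC A) ebSl. Qed.

Lemma eb_eq0 A B : reflect {in A & B, forall x y, e x y = false} (eb A B == 0).
Proof.
rewrite /eb sum_nat_eq0; apply: (iffP forall_inP) => H.
  move=> x y xA yB; have := H x xA; rewrite cards_eq0 => /eqP/setP/(_ y).
  by rewrite !inE yB.
move=> x xA; rewrite cards_eq0; apply/eqP/setP => y; rewrite !inE.
by case yB: (y \in B) => //=; apply: H.
Qed.

Lemma eb_gt0 A B : 0 < eb A B -> exists x y, [/\ x \in A, y \in B & e x y].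
Proof.
rewrite lt0n => /negP nz; have [/existsP[x /existsP[y /and3P[xA yB exy]]]|no] :=
  boolP [exists x, exists y, [&& x \in A, y \in B & e x y]]; first by exists x, y.
case: nz; apply/eb_eq0 => x y xA yB; apply: contraNF no => exy.
by apply/existsP; exists x; apply/existsP; exists y; rewrite xA yB.
Qed.

Lemma dg_set1 x y : dg [set y] x = e x y.
Proof. by rewrite dgE big_set1. Qed.

Lemma dgU A B x : [disjoint A & B] -> dg (A :|: B) x = dg A x + dg B x.
Proof. by move=> dAB; rewrite -!eb_set1l ebUr. Qed.

Lemma dgS A B x : A \subset B -> dg A x <= dg B x.
Proof. by move=> AB; rewrite -!eb_set1l ebSr. Qed.

Lemma dg_le3 A x : dg A x <= 3.
Proof.
apply: leq_trans (Hdeg x); apply: subset_leq_card; apply/subsetP => y.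
by rewrite !inE => /andP[].
Qed.

Lemma disjointDr A B : [disjoint A & B :\: A].
Proof. by rewrite disjoints_subset setDE setCI setCK subsetUr. Qed.

Lemma setUD_id A S : A \subset S -> A :|: S :\: A = S.
Proof. by move=> AS; rewrite -{2}(setID S A) (setIidPr AS). Qed.

Lemma cards_split A S : A \subset S -> #|S| = #|A| + #|S :\: A|.
Proof. by move=> AS; rewrite cardsD (setIidPr AS) subnKC // subset_leq_card. Qed.

Lemma dg_split A S x : A \subset S -> dg S x = dg A x + dg (S :\: A) x.
Proof. by move=> AS; rewrite -dgU ?disjointDr // setUD_id. Qed.

Lemma eb_splitl A S C : A \subset S -> eb S C = eb A C + eb (S :\: A) C.
Proof. by move=> AS; rewrite -ebUl ?disjointDr // setUD_id. Qed.

Lemma eb_splitr A S C : A \subset S -> eb C S = eb C A + eb C (S :\: A).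
Proof. by move=> AS; rewrite !(ebC C) (eb_splitl C AS). Qed.

Lemma eb_D1l A C x : x \in A -> eb A C = dg C x + eb (A :\ x) C.
Proof. by move=> xA; rewrite -eb_set1l -eb_splitl // sub1set. Qed.

Lemma dg_gt0 A x y : y \in A -> e x y -> 0 < dg A x.
Proof. by move=> yA exy; apply/card_gt0P; exists y; rewrite inE yA. Qed.

(** k-edge-connectedness of the induced subgraph: [kconn 1] is connectedness, and [kconn 2] also
    forbids bridges. A single vertex satisfies it for every k. *)
Definition kconn k S : bool :=
  (S != set0) && [forall A : {set T}, [&& A \subset S, A != set0 & A != S] ==> (k <= eb A (S :\: A))].

Lemma kconnP k S :
  reflect (S != set0 /\ forall A, A \subset S -> A != set0 -> A != S -> k <= eb A (S :\: A))
          (kconn k S).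
Proof.
apply: (iffP andP) => [[S0 /forallP H]|[S0 H]]; split=> //.
  by move=> A AS A0 AnS; have := H A; rewrite AS A0 AnS.
by apply/forallP => A; apply/implyP => /and3P[]; apply: H.
Qed.

Lemma kconnW k l S : l <= k -> kconn k S -> kconn l S.
Proof.
move=> lk /kconnP[S0 H]; apply/kconnP; split=> // A AS A0 AnS.
exact: leq_trans lk (H A AS A0 AnS).
Qed.

Lemma kconn_dg k S x : kconn k S -> x \in S -> 1 < #|S| -> k <= dg S x.
Proof.
move=> /kconnP[_ H] xS S1; have := H [set x]; rewrite sub1set xS.
have -> : [set x] != set0 by apply/set0Pn; exists x; rewrite inE.
have -> : [set x] != S by apply: contraTneq S1 => <-; rewrite cards1.
by move=> /(_ isT isT isT)/leq_trans; apply; rewrite eb_set1l dgS // subsetDl.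
Qed.

Definition noncubic S : bool := [exists x in S, dg S x <= 2].
(* By [bounded_described], the vertex number of a bad graph is 3 nu + 1. *)
Definition bad S : bool := [&& kconn 1 S, noncubic S & 3 * nu S < #|S|].

Definition comps S : {set {set T}} :=
  [set A : {set T} | [&& A \subset S, kconn 1 A & eb A (S :\: A) == 0]].
(** There is no degree condition as in [bad]: components left by deleting vertices of a connected
    graph satisfy it automatically ([badc_bad]). *)
Definition badc S : {set {set T}} := [set A in comps S | 3 * nu A < #|A|].

Lemma compsP S A : reflect [/\ A \subset S, kconn 1 A & eb A (S :\: A) = 0] (A \in comps S).
Proof. by rewrite inE; apply: (iffP and3P) => [[? ? /eqP]|[? ? /eqP]]. Qed.

Lemma badc_sub S : badc S \subset comps S.
Proof. by apply/subsetP => A; rewrite inE => /andP[]. Qed.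

Lemma comps_sub S A B : A \in comps S -> B \in comps S -> A :&: B != set0 -> A \subset B.
Proof.
move=> /compsP[AS /kconnP[_ cA] _] /compsP[BS _ cB] AB0.
apply: contraT => nAB; have := cA (A :&: B) (subsetIl _ _) AB0.
have -> : A :&: B != A by apply: contraNneq nAB => <-; apply: subsetIr.
move=> /(_ isT); suff: eb (A :&: B) (A :\: (A :&: B)) <= 0 by case: (eb _ _).
rewrite -cB; apply: leq_trans (ebSl _ (subsetIr A B)) _; apply: ebSr.
apply/subsetP => x; rewrite !inE negb_and => /andP[/orP[/negbTE->//|->] xA].
by rewrite (subsetP AS).
Qed.

Lemma comps_disjoint S A B : A \in comps S -> B \in comps S -> A != B -> [disjoint A & B].
Proof.
move=> cA cB nAB; rewrite -setI_eq0; apply: contraR nAB => AB0.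
by rewrite eqEsubset (comps_sub cA cB) // (comps_sub cB cA) // setIC.
Qed.

Lemma comps_trivIset S F : F \subset comps S -> trivIset F.
Proof.
move=> /subsetP FS; apply/trivIsetP => A B /FS cA /FS cB; exact: comps_disjoint cA cB.
Qed.

Lemma sum_eb_comps S F D : F \subset comps S -> \sum_(A in F) eb A D = eb (cover F) D.
Proof. by move=> FS; rewrite /eb big_trivIset // (comps_trivIset FS). Qed.

Lemma cover_comps S F : F \subset comps S -> cover F \subset S.
Proof. by move=> /subsetP FS; apply/bigcupsP => A /FS/compsP[]. Qed.

Lemma cover_closed S F : F \subset comps S -> eb (S :\: cover F) (cover F) = 0.
Proof.
move=> FS; rewrite ebC -(sum_eb_comps _ FS); apply/eqP; rewrite sum_nat_eq0.
apply/forall_inP => A AF; have /compsP[_ _ A0] := subsetP FS _ AF.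
rewrite -leqn0 -A0 ebSr // setDS //; apply/subsetP => x xA.
by apply/bigcupP; exists A.
Qed.

(** A smallest nonempty subset that no edge of [S] leaves is connected. *)
Lemma exists_comp S : S != set0 -> exists A, A \in comps S.
Proof.
move=> S0; pose P (A : {set T}) := [&& A \subset S, A != set0 & eb A (S :\: A) == 0].
have PS : P S.
  by rewrite /P subxx S0 setDv; apply/eqP; apply: big1 => x _; rewrite dgE big_set0.
case: (arg_minnP (fun A : {set T} => #|A|) PS) => A /and3P[AS A0 /eqP cA] minA.
exists A; apply/compsP; split=> //; apply/kconnP; split=> // X XA X0 XnA.
rewrite lt0n; apply: contraNneq XnA => eX; rewrite eqEcard XA minA //.
rewrite /P (subset_trans XA) // X0 -leqn0 /=.
have -> : S :\: X = (A :\: X) :|: (S :\: A).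
  apply/setP => x; rewrite !inE; move: (subsetP XA x) (subsetP AS x).
  by case: (x \in X) => [/(_ isT)->|_]; case: (x \in A) => // /(_ isT)->.
rewrite ebUr ?eX ?add0n; first by rewrite -cA ebSl.
by rewrite -setI_eq0; apply/eqP/setP => x; rewrite !inE; case: (x \in A); rewrite ?andbF.
Qed.

Lemma nu_disjoint A B : [disjoint A & B] -> eb A B = 0 -> nu A + nu B <= nu (A :|: B).
Proof.
move=> dAB /eqP/eb_eq0 H.
have [->|/set0Pn[x xA]] := eqVneq A set0.
  rewrite set0U; suff -> : nu set0 = 0 by [].
  apply/eqP; rewrite -leqn0; apply/bigmax_leqP => M /andP[/urP[mM _]].
  rewrite subset0 => /eqP c0.
  by have := card_cover_matching mM; rewrite c0 cards0; case: #|M|.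
by apply: (nu_union (b := x)) => // y z yA zB; rewrite H.
Qed.

(** Split off one component at a time: nu is superadditive, a bad component contributes a deficit of
    1 and any other none. *)
Lemma card_le_nu_badc S : (forall A, A \in comps S -> #|A| <= 3 * nu A + 1) ->
  #|S| <= 3 * nu S + #|badc S|.
Proof.
have [n] := ubnP #|S|; elim: n S => // n IH S leS H.
have [->|S0] := eqVneq S set0; first by rewrite cards0.
have [A cA] := exists_comp S0; have [AS kA eA] := compsP _ _ cA.
have A0 : A != set0 by case/andP: kA.
have sub : comps (S :\: A) \subset comps S :\ A.
  apply/subsetP => B /compsP[BS kB eB].
  have BnA : B != A.
    case/andP: kB => /set0Pn[x xB] _; apply: contraTneq (subsetP BS _ xB) => eBA.
    by rewrite inE -eBA xB.
  rewrite !inE BnA kB (subset_trans BS) ?subsetDl //=.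
  rewrite -leqn0; have -> : S :\: B = A :|: ((S :\: A) :\: B).
    apply/setP => x; move: (subsetP BS x) (subsetP AS x); rewrite !inE.
    case: (x \in B) => [/(_ isT)/andP[/negbTE-> ->]|_]; first by case: (x \in A).
    by case: (x \in A) => // /(_ isT)->.
  rewrite ebUr; last first.
    by rewrite -setI_eq0; apply/eqP/setP => x; rewrite !inE; case: (x \in A); rewrite ?andbF.
  by rewrite eB addn0 -eA (ebC A) ebSl.
have cardS := cards_split AS.
have lt : #|S :\: A| < n.
  by move: A0 leS; rewrite -card_gt0 cardS; move: #|A| #|_| => p q; clear; lia.
have H' B : B \in comps (S :\: A) -> #|B| <= 3 * nu B + 1.
  by move=> /(subsetP sub); rewrite inE => /andP[_ /H].
have := IH _ lt H'.
have := nu_disjoint (disjointDr A S) eA; rewrite setUD_id //.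
have := H _ cA.
have bsub : badc (S :\: A) \subset badc S :\ A.
  apply/subsetP => B; rewrite inE => /andP[/(subsetP sub)].
  by rewrite in_setD1 => /andP[BA cB] bB; rewrite in_setD1 BA inE cB.
have := subset_leq_card bsub; rewrite (cardsD1 A (badc S)) [A \in badc S]inE cA cardS /=.
case: ltnP; move: (nu _) (nu _) (nu _) #|_| #|_| #|_| #|_| => p q r s t u v; clear; lia.
Qed.

(** * Induced copies of explicit graphs *)

Definition realizes s g : Prop :=
  [/\ uniq s, size s = size g, all (all (fun j => j < size g)) g &
      forall i j, i < size g -> j < size g -> e (nth x0 s i) (nth x0 s j) = adj g i j].

Lemma realizes_rcons s g y l : realizes s g -> y \notin s ->
  (forall j, j < size g -> e y (nth x0 s j) = (j \in l)) -> all (fun j => j < size g) l ->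
  realizes (rcons s y) (rcons g l).
Proof.
case=> us ss wf es ys ey wl.
have wf' j : j < size g -> size g \notin nth [::] g j.
  move=> jg; have /allP/(_ (size g)) := all_nthP [::] wf j jg.
  by rewrite ltnn; case: (_ \in _) => // /(_ isT).
split.
- by rewrite rcons_uniq ys.
- by rewrite !size_rcons ss.
- rewrite all_rcons size_rcons; apply/andP; split.
    by apply: sub_all wl => j /ltnW; rewrite ltnS.
  by apply: sub_all wf => r; apply: sub_all => j /ltnW; rewrite ltnS.
move=> i j; rewrite size_rcons /adj !nth_rcons ss !ltnS [i <= _]leq_eqVlt [j <= _]leq_eqVlt.
case/orP=> [/eqP->|ig] /orP[/eqP->|jg]; rewrite ?ltnn ?eqxx ?ig ?jg.
- by rewrite e_irr orbb; apply/esym/negP => /(allP wl); rewrite ltnn.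
- by rewrite ey // (negbTE (wf' _ jg)) orbF.
- by rewrite e_sym ey // (negbTE (wf' _ ig)).
- by rewrite es.
Qed.

Lemma size_nbrs g : size (nbrs g) = size g.
Proof. by rewrite size_map size_iota. Qed.

Lemma nth_nbrs g i : i < size g -> nth [::] (nbrs g) i = [seq j <- iota 0 (size g) | adj g i j].
Proof. by move=> ig; rewrite (nth_map 0) ?size_iota // nth_iota. Qed.

Lemma mem_nbrs g i j : i < size g -> (j \in nth [::] (nbrs g) i) = (j < size g) && adj g i j.
Proof. by move=> ig; rewrite nth_nbrs // mem_filter mem_iota add0n andbC. Qed.

Lemma uniq_nbrs g i : i < size g -> uniq (nth [::] (nbrs g) i).
Proof. by move=> ig; rewrite nth_nbrs // filter_uniq // iota_uniq. Qed.

Lemma realizes_inj s g i j : realizes s g -> i < size g -> j < size g ->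
  (nth x0 s i == nth x0 s j) = (i == j).
Proof. by case=> us ss _ _ ig jg; rewrite nth_uniq ?ss. Qed.

Lemma size_image s g (l : seq nat) (A : {set T}) : realizes s g -> uniq l ->
  {in l, forall i, i < size g} -> {in l, forall i, nth x0 s i \in A} -> size l <= #|A|.
Proof.
move=> rs ul wl lA; rewrite -(size_map (nth x0 s)) cardE; apply: uniq_leq_size.
  rewrite map_inj_in_uniq // => i j /wl ig /wl jg /eqP.
  by rewrite (realizes_inj rs) // => /eqP.
by move=> x /mapP[i il ->]; rewrite mem_enum lA.
Qed.

(** Adjacent vertices with a common neighbour form a triangle, and two common neighbours close a
    4-cycle. *)
Lemma realizes_sparse s g : realizes s g -> sparse g.
Proof.
move=> rs; have [us ss _ es] := rs; apply/andP; split.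
  apply/(all_nthP [::]) => i; rewrite size_nbrs => ig.
  apply: leq_trans (Hdeg (nth x0 s i)); apply: size_image rs _ _ _; first exact: uniq_nbrs.
    by move=> j; rewrite mem_nbrs // => /andP[].
  by move=> j; rewrite mem_nbrs // inE => /andP[jg]; rewrite es.
apply/allP => i; rewrite mem_iota add0n /= => ig; apply/allP => j; rewrite mem_iota add0n /= => jg.
case: eqP => //= /eqP ij; rewrite mem_nbrs // jg /=.
have sz : size [seq k <- nth [::] (nbrs g) i | k \in nth [::] (nbrs g) j] <=
    #|[set z | e (nth x0 s i) z && e (nth x0 s j) z]|.
  apply: size_image rs _ _ _; first exact/filter_uniq/uniq_nbrs.
    by move=> k; rewrite mem_filter mem_nbrs // => /andP[_]; rewrite mem_nbrs // => /andP[].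
  move=> k; rewrite mem_filter !mem_nbrs // inE => /andP[/andP[kg jk] /andP[_ ik]].
  by rewrite !es // ik jk.
apply: leq_trans (leq_add sz (leqnn _)) _; rewrite -es //.
have [no3 no4] := Hgirth.
have [eij|_] := boolP (e _ _); rewrite ?addn0 ?addn1.
  rewrite ltnS leqn0 cards_eq0; apply/eqP/setP => z; rewrite !inE; apply/negP => /andP[e1 e2].
  by apply: (no3 (nth x0 s i) (nth x0 s j) z); rewrite eij e2 e_sym e1.
apply/card_le1_eqP => y z; rewrite !inE => /andP[e1 e2] /andP[e3 e4]; apply/eqP.
apply: contraT => yz; case: (no4 (nth x0 s i) y (nth x0 s j) z) => //.
- by rewrite (realizes_inj rs).
- by rewrite eq_sym.
by rewrite e1 e4 (e_sym y) e2 (e_sym z) e3.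
Qed.

Lemma realizes_open s g i y : realizes s g -> i < size g -> y \notin s ->
  e (nth x0 s i) y -> i \in open_ends g.
Proof.
move=> rs ig ys ey; have [us ss _ es] := rs.
rewrite mem_filter mem_iota add0n /= ig andbT -ltnS.
have := Hdeg (nth x0 s i); rewrite (cardsD1 y) inE ey add1n => H; apply: leq_trans H.
rewrite ltnS; apply: size_image rs _ _ _; first exact: uniq_nbrs.
  by move=> j; rewrite mem_nbrs // => /andP[].
move=> j; rewrite mem_nbrs // !inE => /andP[jg]; rewrite es // => ->; rewrite andbT.
by apply: contraNneq ys => <-; rewrite mem_nth // ss.
Qed.

Definition masked s (m : bitseq) : {set T} := [set x in s | nth false m (index x s)].

Lemma nth_clear m l j : nth false (clear m l) j = nth false m j && (j \notin l).
Proof.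
elim: l => [|i l IH] /=; first by rewrite andbT.
by rewrite nth_set_nth /= IH inE negb_or; case: eqP; rewrite ?andbF.
Qed.

Lemma size_clear m l : all (fun j => j < size m) l -> size (clear m l) = size m.
Proof. by elim: l => //= i l IH /andP[im /IH sl]; rewrite size_set_nth sl (maxn_idPr _). Qed.

Lemma masked_peel s g m (u : nat) : realizes s g -> size m = size g ->
  u < size g -> nth false m u -> 0 < count (nth false m) (nth [::] (nbrs g) u) ->
  (nu (masked s (clear m (u :: nth [::] (nbrs g) u)))).+1 <= nu (masked s m).
Proof.
move=> rs sm ug mu; rewrite -has_count => /hasP[v]; rewrite mem_nbrs // => /andP[vg uv] mv.
have [us ss _ es] := rs.
apply: leq_trans (nu_peel (u := nth x0 s u) (v := nth x0 s v) _ _ _).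
- rewrite ltnS; apply: nuS => //; apply/subsetP => x; rewrite !inE nth_clear inE.
  case/andP=> xs /andP[mx]; rewrite negb_or => /andP[xu nux].
  have xg : index x s < size g by rewrite -ss index_mem.
  rewrite xs mx !andbT negb_or; apply/andP; split.
    by apply: contra xu => /eqP->; rewrite index_uniq ?ss.
  by move: nux; rewrite mem_nbrs // xg /= -es // nth_index.
- by rewrite inE mem_nth ?ss //= index_uniq ?ss.
- by rewrite inE mem_nth ?ss //= index_uniq ?ss.
- by rewrite es.
Qed.

Lemma size_clear_nbrs g m (u : nat) : size m = size g -> u < size g ->
  size (clear m (u :: nth [::] (nbrs g) u)) = size g.
Proof.
move=> sm ug; rewrite size_clear ?sm //= ug; apply/allP => j.
by rewrite mem_nbrs // => /andP[].
Qed.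

Lemma realizes_greedy s g k m : realizes s g -> size m = size g ->
  greedy (nbrs g) k m -> k <= nu (masked s m).
Proof.
move=> rs; elim: k m => // k IH m sm /=.
set deg := fun u : nat => _.
suff step (u : nat) : u < size g -> 0 < deg u -> greedy (nbrs g) k (clear m (u :: nth [::] (nbrs g) u)) ->
    k < nu (masked s m).
  rewrite sm.
  have degE i : i < size g -> nth 0 [seq deg u | u <- iota 0 (size g)] i = deg i.
    by move=> ig; rewrite (nth_map 0) ?size_iota // nth_iota.
  case: ifP => [d1|_].
    have i1 : index 1 [seq deg u | u <- iota 0 (size g)] < size g.
      by move: d1; rewrite -index_mem size_map size_iota.
    by apply: step => //; rewrite -degE // nth_index.
  rewrite -[X in _ < X -> _](size_iota 0) -has_find => /hasP[u]; rewrite mem_iota add0n /= => ug.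
  rewrite degE //; case: eqP => // du.
  by apply: step => //; rewrite du; case: ifP.
rewrite /deg; case: ifP => // mu ug du gr.
apply: leq_ltn_trans (masked_peel rs sm ug mu du).
by apply: IH gr; rewrite size_clear_nbrs.
Qed.

Lemma masked_full s g : realizes s g -> masked s (nseq (size g) true) = [set x in s].
Proof.
case=> _ ss _ _; apply/setP => x; rewrite !inE nth_nseq -ss index_mem.
by case: (x \in s).
Qed.

Lemma realizes_greedy_size s g k : realizes s g -> greedy_size g k -> k <= nu [set x in s].
Proof.
move=> rs; rewrite /greedy_size -(masked_full rs).
case: ifP => [gr _|_]; first by apply: realizes_greedy gr; rewrite ?size_nseq.
rewrite -[X in _ < X -> _](size_iota 0) -has_find => /hasP[u]; rewrite mem_iota add0n /= => ug.
case E : (nth [::] (nbrs g) u) => [//|v r]; rewrite -E => gr.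
case: k gr => // k gr; apply: leq_ltn_trans (masked_peel rs _ ug _ _).
- by apply: realizes_greedy gr => //; rewrite size_clear_nbrs ?size_nseq.
- by rewrite size_nseq.
- by rewrite nth_nseq ug.
rewrite -has_count; apply/hasP; exists v; first by rewrite E inE eqxx.
have : v \in nth [::] (nbrs g) u by rewrite E inE eqxx.
by rewrite mem_nbrs // nth_nseq => /andP[->].
Qed.

Lemma is_isoP g h l : is_iso g h l ->
  [/\ size h = size g, size l = size g, uniq l, {in l, forall i, i < size g} &
   forall i j, i < size g -> j < size g -> adj g (nth 0 l i) (nth 0 l j) = adj h i j].
Proof.
case/and5P => /eqP sh /eqP sl ul /allP wl /allP H; split=> // i j ig jg.
have /H/allP/(_ j) : i \in iota 0 (size g) by rewrite mem_iota.
by rewrite mem_iota => /(_ jg)/eqP.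
Qed.

Lemma realizes_iso s g h l : all (all (fun j => j < size h)) h -> realizes s g ->
  is_iso g h l -> realizes [seq nth x0 s i | i <- l] h /\ [seq nth x0 s i | i <- l] =i s.
Proof.
move=> wh rs /is_isoP[sh sl ul wl ee]; have [us ss _ es] := rs.
have ul' : uniq [seq nth x0 s i | i <- l].
  rewrite map_inj_in_uniq // => i j /wl ig /wl jg /eqP.
  by rewrite (realizes_inj rs) // => /eqP.
split; last first.
  have [||_ //] := uniq_min_size ul' (s2 := s) => [x /mapP[i /wl ig ->]|].
    by rewrite mem_nth ?ss.
  by rewrite size_map ss sl.
split=> // [|i j]; first by rewrite size_map sh sl.
rewrite sh => ig jg; rewrite !(nth_map 0) ?sl // es ?wl ?mem_nth ?sl //.
exact: ee.
Qed.

Lemma find_isoP g h : find_iso g h -> exists l, is_iso g h l.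
Proof.
rewrite /find_iso; case: ifP => // _; case: (embed _ _ _) => // l; by exists l.
Qed.

(** * Attaching a path, a hexagon or a claw to a block *)

Definition modelled (gs : seq lgraph) A : Prop :=
  exists2 s, A = [set x in s] & exists2 g, g \in gs & realizes s g.
Definition block A : Prop := modelled blocks A.

Lemma card_realizes s g : realizes s g -> #|[set x in s]| = size g.
Proof. by case=> us ss _ _; rewrite cardsE (card_uniqP us). Qed.

Lemma ext_okP known s g : ext_ok known g -> realizes s g ->
  #|[set x in s]| <= 3 * nu [set x in s] \/ block [set x in s].
Proof.
rewrite /ext_ok => + rs; rewrite (realizes_sparse rs); case: ifP => _.
  case/hasP=> h hb /find_isoP[l il]; right.
  have wh : all (all (fun j => j < size h)) h.
    by move: h hb {il}; apply/allP; vm_compute.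
  have [rh eqs] := realizes_iso wh rs il.
  exists [seq nth x0 s i | i <- l]; first by apply/setP => x; rewrite !inE eqs.
  by exists h.
move=> gr; left; have := realizes_greedy_size rs gr; rewrite (card_realizes rs).
have := leq_divLR; lia.
Qed.

Lemma no_triangle x y z : e x y -> e y z -> e z x = false.
Proof.
by move=> exy eyz; apply/negP => ezx; case: Hgirth => /(_ x y z) []; rewrite exy eyz ezx.
Qed.

Lemma no_square x y z w : e x y -> e y z -> e z w -> e w x -> x != z -> y = w.
Proof.
move=> e1 e2 e3 e4 xz; apply/eqP; apply: contraT => yw.
by case: Hgirth => _ /(_ x y z w xz yw)[].
Qed.

(** [a = b] is allowed and means a single neighbour, matching the repeated indices in [path_ok]. *)
Definition two_ends A v a b : Prop :=
  [/\ a \in A, b \in A & forall z, z \in A -> e v z = (z == a) || (z == b)].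

Lemma two_endsC A v a b : two_ends A v a b -> two_ends A v b a.
Proof. by case=> aA bA ev; split=> // z /ev; rewrite orbC. Qed.

Lemma index_mem_realizes s g a : realizes s g -> a \in s -> index a s < size g.
Proof. by case=> _ <- _ _; rewrite index_mem. Qed.

Lemma index_open s g A v a : realizes s g -> A = [set x in s] -> v \notin A ->
  a \in A -> e v a -> index a s \in open_ends g.
Proof.
move=> rs eA; rewrite eA !inE => vs as_ eva.
apply: (realizes_open rs _ vs); first exact: index_mem_realizes rs as_.
by rewrite nth_index // e_sym.
Qed.

Lemma two_ends_sorted s A v a b : two_ends A v a b ->
  exists a' b', two_ends A v a' b' /\ index a' s <= index b' s.
Proof.
move=> tv; case: (leqP (index a s) (index b s)) => [|/ltnW] le_ab; first by exists a, b.
by exists b, a; split=> //; apply: two_endsC.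
Qed.

Lemma path_tableP g i j k l : g \in blocks -> i \in open_ends g -> j \in open_ends g ->
  k \in open_ends g -> l \in open_ends g -> i <= j -> i <= k -> k <= l ->
  exists known, ext_ok known (ext_path g i j k l).
Proof.
rewrite -[blocks]/(map fst path_table) => /mapP[[g' known] pt /= ->] Ii Ij Ik Il ij ik kl.
have := allP path_table_ok _ pt.
move=> /allP/(_ i Ii)/allP/(_ j Ij)/allP/(_ k Ik)/allP/(_ l Il).
by rewrite ij ik kl; exists ([:: i; j; k; l] \in known).
Qed.

Lemma hex_tableP g i j k : g \in K13 :: blocks -> i \in open_ends g -> j \in open_ends g ->
  k \in open_ends g -> i <= j -> j <= k -> exists known, ext_ok known (ext_hex g i j k).
Proof.
rewrite -[K13 :: blocks]/(map fst hex_table) => /mapP[[g' known] pt /= ->] Ii Ij Ik ij jk.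
have := allP hex_table_ok _ pt.
move=> /allP/(_ i Ii)/allP/(_ j Ij)/allP/(_ k Ik).
by rewrite ij jk; exists ([:: i; j; k] \in known).
Qed.

(* Adding one vertex at a time: [l] lists the indices of the neighbours of [y]. *)
Lemma realizes_add s g y l : realizes s g -> y \notin s ->
  (forall z, z \in s -> e y z = (index z s \in l)) -> all (fun j => j < size g) l ->
  realizes (rcons s y) (rcons g l).
Proof.
move=> rs ys ey wl; apply: realizes_rcons => // j jg.
have [us ss _ _] := rs.
by rewrite ey ?mem_nth ?ss // index_uniq ?ss.
Qed.

Lemma index_rcons s y z : index z (rcons s y) =
  if z \in s then index z s else if z == y then size s else (size s).+1.
Proof.
rewrite -cats1 index_cat /=; case: ifP => // _.
by rewrite (eq_sym z); case: eqP => _; rewrite ?addn0 ?addn1.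
Qed.

(** Choosing names so that the attachments are in the order required by [path_ok] turns this into a
    table lookup; the only edges among [u], [v], [w] are the given two, as there is no triangle. *)
Lemma block_path A u v w a b c d : block A ->
  u \notin A -> v \notin A -> w \notin A -> v != w -> e u v -> e u w ->
  (forall z, z \in A -> e u z = false) -> two_ends A v a b -> two_ends A w c d ->
  #|A :|: [set u; v; w]| <= 3 * nu (A :|: [set u; v; w]) \/ block (A :|: [set u; v; w]).
Proof.
case=> s eA [g gB rs] uA + + + + + euA.
move=> + + + + + /(two_ends_sorted s)[a' [b' [+ +]]] /(two_ends_sorted s)[c' [d' [+ +]]].
move: a' b' c' d' => {}a {}b {}c {}d.
have sA x : (x \in A) = (x \in s) by rewrite eA inE.
(* All hypotheses and the vertex set are symmetric in the two ends of the path. *)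
wlog lac : v w a b c d / index a s <= index c s.
  move=> H vA wA vw euv euw tv lab tw lcd.
  case: (leqP (index a s) (index c s)) => [lac|/ltnW lca].
    exact: (H v w a b c d).
  by rewrite setUAC; apply: (H w v c d a b) => //; rewrite eq_sym.
move=> vA wA vw euv euw [aA bA ev] lab [cA dA ew] lcd.
have evw : e v w = false by apply/negP => evw; have := no_triangle euv evw; rewrite e_sym euw.
have uv : u != v by apply: contraTneq euv => ->; rewrite e_irr.
have uw : u != w by apply: contraTneq euw => ->; rewrite e_irr.
have ss : size s = size g by case: rs.
have op v' z : v' \notin A -> z \in A -> e v' z -> index z s \in open_ends g.
  by move=> v'A zA ez; apply: (index_open rs eA v'A).
have Ia : index a s \in open_ends g by apply: (op v) => //; rewrite ev // eqxx.
have Ib : index b s \in open_ends g by apply: (op v) => //; rewrite ev // eqxx orbT.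
have Ic : index c s \in open_ends g by apply: (op w) => //; rewrite ew // eqxx.
have Id : index d s \in open_ends g by apply: (op w) => //; rewrite ew // eqxx orbT.
have [known ok] := path_tableP gB Ia Ib Ic Id lab lac lcd.
have idx z : z \in A -> index z s < size g by rewrite sA; apply: index_mem_realizes.
have eqi x y : x \in A -> y \in A -> (index x s == index y s) = (x == y).
  rewrite !sA => xs ys; apply/eqP/eqP => [|->//] exy.
  by rewrite -(nth_index x0 xs) exy nth_index.
have r1 : realizes (rcons s v) (rcons g [:: index a s; index b s]).
  apply: realizes_add => //=; rewrite -?sA ?idx // => z.
  by rewrite -sA => zA; rewrite ev // !inE !eqi.
have r2 : realizes (rcons (rcons s v) w)
    (rcons (rcons g [:: index a s; index b s]) [:: index c s; index d s]).
  apply: realizes_add => //=.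
  - by rewrite mem_rcons inE -sA negb_or eq_sym vw.
  - move=> z; rewrite mem_rcons inE index_rcons => /orP[/eqP->|zs].
      rewrite e_sym evw -sA (negbTE vA) eqxx ss !inE.
      by rewrite (gtn_eqF (idx _ cA)) (gtn_eqF (idx _ dA)).
    have zA : z \in A by rewrite sA.
    by rewrite zs ew // !inE !eqi.
  - by rewrite size_rcons !ltnS (ltnW (idx _ cA)) (ltnW (idx _ dA)).
have r3 : realizes (rcons (rcons (rcons s v) w) u) (ext_path g (index a s) (index b s) (index c s) (index d s)).
  have -> : ext_path g (index a s) (index b s) (index c s) (index d s) =
    rcons (rcons (rcons g [:: index a s; index b s]) [:: index c s; index d s])
          [:: size g; (size g).+1] by rewrite -!cats1 -!catA.
  apply: realizes_add => //=.
  - by rewrite !(mem_rcons, inE) -sA !negb_or uw uv.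
  - move=> z; rewrite !(mem_rcons, inE) !index_rcons !(mem_rcons, inE) !size_rcons ss.
    case/or3P=> [/eqP->|/eqP->|zs].
    + by rewrite eqxx -sA (negbTE wA) (eq_sym w) (negbTE vw) euw eqxx orbT.
    + by rewrite eqxx -sA (negbTE vA) euv eqxx.
    + rewrite zs orbT euA ?sA //.
      have zg : index z s < size g by apply: idx; rewrite sA.
      by rewrite (ltn_eqF zg) (ltn_eqF (leqW zg)).
  - by rewrite !size_rcons !ltnS leqnn leqnSn.
have -> : A :|: [set u; v; w] = [set x in rcons (rcons (rcons s v) w) u].
  apply/setP => x; rewrite !inE !(mem_rcons, inE) sA.
  by case: (x == u); case: (x == v); case: (x == w); case: (x \in s).
exact: ext_okP ok r3.
Qed.

(** The 6-cycle is x1 y12 x2 y23 x3 y13, and only the [x] vertices reach [A]. The absence of chords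
    is left to the girth condition. *)
Definition hexagon A x1 x2 x3 y12 y13 y23 a1 a2 a3 : Prop :=
  [/\ uniq [:: x1; x2; x3; y12; y13; y23],
      {in A, forall z, z \notin [:: x1; x2; x3; y12; y13; y23]},
      ([/\ e x1 y12, e x1 y13 & e x2 y12] /\ [/\ e x2 y23, e x3 y13 & e x3 y23]),
      [/\ a1 \in A, a2 \in A & a3 \in A] &
      {in A, forall z, [/\ e x1 z = (z == a1), e x2 z = (z == a2) & e x3 z = (z == a3)] /\
                       [/\ e y12 z = false, e y13 z = false & e y23 z = false]}].

(** This swap and [hexagon_swap23] generate all permutations of the three attachments, which allows
    [block_hex] to sort them. *)
Lemma hexagon_swap12 A x1 x2 x3 y12 y13 y23 a1 a2 a3 :
  hexagon A x1 x2 x3 y12 y13 y23 a1 a2 a3 -> hexagon A x2 x1 x3 y12 y23 y13 a2 a1 a3.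
Proof.
move=> [u sA [[e1 e2 e3] [e4 e5 e6]] [A1 A2 A3] eA]; split=> //.
- rewrite (perm_uniq (s2 := [:: x1; x2; x3; y12; y13; y23])) //.
  by apply/permP => p /=; ring.
- by move=> z /sA; rewrite !inE; case: (z == x1); case: (z == x2); case: (z == x3);
    case: (z == y12); case: (z == y13); case: (z == y23).
- by move=> z /eA[[? ? ?] [? ? ?]].
Qed.

Lemma hexagon_swap23 A x1 x2 x3 y12 y13 y23 a1 a2 a3 :
  hexagon A x1 x2 x3 y12 y13 y23 a1 a2 a3 -> hexagon A x1 x3 x2 y13 y12 y23 a1 a3 a2.
Proof.
move=> [u sA [[e1 e2 e3] [e4 e5 e6]] [A1 A2 A3] eA]; split=> //.
- rewrite (perm_uniq (s2 := [:: x1; x2; x3; y12; y13; y23])) //.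
  by apply/permP => p /=; ring.
- by move=> z /sA; rewrite !inE; case: (z == x1); case: (z == x2); case: (z == x3);
    case: (z == y12); case: (z == y13); case: (z == y23).
- by move=> z /eA[[? ? ?] [? ? ?]].
Qed.

Lemma hexagon_set12 (x1 x2 x3 y12 y13 y23 : T) :
  [set z in [:: x2; x1; x3; y12; y23; y13]] = [set z in [:: x1; x2; x3; y12; y13; y23]].
Proof.
by apply/setP => z; rewrite !inE; case: (z == x1); case: (z == x2); case: (z == x3);
  case: (z == y12); case: (z == y13); case: (z == y23).
Qed.

Lemma hexagon_set23 (x1 x2 x3 y12 y13 y23 : T) :
  [set z in [:: x1; x3; x2; y13; y12; y23]] = [set z in [:: x1; x2; x3; y12; y13; y23]].
Proof.
by apply/setP => z; rewrite !inE; case: (z == x1); case: (z == x2); case: (z == x3);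
  case: (z == y12); case: (z == y13); case: (z == y23).
Qed.

Lemma leq_addS n : ((n <= n) = true) * ((n <= n.+1) = true) * ((n <= n.+2) = true) *
  ((n <= n.+3) = true) * ((n <= n.+4) = true).
Proof. by do !split; lia. Qed.

Lemma eqS_neq n : ((n.+1 == n) = false) * ((n.+2 == n) = false) * ((n.+3 == n) = false) *
  ((n.+4 == n) = false) * ((n == n.+1) = false) * ((n == n.+2) = false).
Proof. by do !split; lia. Qed.

Lemma block_hex A x1 x2 x3 y12 y13 y23 a1 a2 a3 (B := A :|: [set z in [:: x1; x2; x3; y12; y13; y23]]) :
  modelled (K13 :: blocks) A -> hexagon A x1 x2 x3 y12 y13 y23 a1 a2 a3 ->
  #|B| <= 3 * nu B \/ block B.
Proof.
rewrite {}/B; case=> s eA [g gB rs].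
have sA x : (x \in A) = (x \in s) by rewrite eA inE.
pose ix a := index a s.
wlog le12 : x1 x2 x3 y12 y13 y23 a1 a2 a3 / ix a1 <= ix a2.
  move=> H h; case: (leqP (ix a1) (ix a2)) => [le|/ltnW le]; first exact: H h.
  by have := H _ _ _ _ _ _ _ _ _ le (hexagon_swap12 h); rewrite hexagon_set12.
wlog le23 : x1 x2 x3 y12 y13 y23 a1 a2 a3 le12 / ix a2 <= ix a3.
  move=> H h; case: (leqP (ix a2) (ix a3)) => [le|/ltnW le23]; first exact: H h.
  have h' := hexagon_swap23 h.
  case: (leqP (ix a1) (ix a3)) => [le13|/ltnW le13].
    by have := H _ _ _ _ _ _ _ _ _ le13 le23 h'; rewrite hexagon_set23.
  by have := H _ _ _ _ _ _ _ _ _ le13 le12 (hexagon_swap12 h'); rewrite hexagon_set12 hexagon_set23.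
case=> u sx [[e1 e2 e3] [e4 e5 e6]] [A1 A2 A3] eAz.
have xA z : z \in [:: x1; x2; x3; y12; y13; y23] -> z \notin A.
  by move=> zx; apply/negP => /sx; rewrite zx.
have [x1A x2A x3A] : [/\ x1 \notin A, x2 \notin A & x3 \notin A].
  by split; apply: xA; rewrite !inE eqxx ?orbT.
have [y1A y2A y3A] : [/\ y12 \notin A, y13 \notin A & y23 \notin A].
  by split; apply: xA; rewrite !inE eqxx ?orbT.
have ss : size s = size g by case: rs.
have op v a : v \notin A -> a \in A -> e v a -> index a s \in open_ends g.
  by move=> vA aA ea; apply: (index_open rs eA vA).
have I1 : ix a1 \in open_ends g by apply: (op x1) => //; have [[-> _ _] _] := eAz _ A1.
have I2 : ix a2 \in open_ends g by apply: (op x2) => //; have [[_ -> _] _] := eAz _ A2.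
have I3 : ix a3 \in open_ends g by apply: (op x3) => //; have [[_ _ ->] _] := eAz _ A3.
have [known ok] := hex_tableP gB I1 I2 I3 le12 le23.
have idx z : z \in A -> index z s < size g by rewrite sA; apply: index_mem_realizes.
have eqi x y : x \in A -> y \in A -> (index x s == index y s) = (x == y).
  rewrite !sA => xs ys; apply/eqP/eqP => [|->//] exy.
  by rewrite -(nth_index x0 xs) exy nth_index.
have [u1 u2 u3 u4 u5] : [/\ x1 \notin [:: x2; x3; y12; y13; y23], x2 \notin [:: x3; y12; y13; y23],
   x3 \notin [:: y12; y13; y23], y12 \notin [:: y13; y23] & y13 \notin [:: y23]].
  by move: u => /= /and5P[-> -> -> -> /andP[->]].
move: u1 u2 u3 u4 u5; rewrite !inE !negb_or.
move=> /and5P[x12 x13 x1y1 x1y2 x1y3] /and4P[x23 x2y1 x2y2 x2y3] /and3P[x3y1 x3y2 x3y3] /andP[y1y2 y1y3] y2y3.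
(* A chord between vertices at distance 2 would close a triangle, one between opposite vertices a
   4-cycle. *)
have n12 : e x1 x2 = false by rewrite e_sym (no_triangle e1) // e_sym.
have n13 : e x1 x3 = false by rewrite e_sym (no_triangle e2) // e_sym.
have n23 : e x2 x3 = false by rewrite e_sym (no_triangle e4) // e_sym.
have m12 : e y12 y13 = false by rewrite e_sym (no_triangle _ e2) // e_sym.
have m13 : e y12 y23 = false by rewrite e_sym (no_triangle _ e4) // e_sym.
have m23 : e y13 y23 = false by rewrite e_sym (no_triangle _ e6) // e_sym.
have p1 : e y12 x3 = false.
  apply: contraNF y1y3 => ey; apply/eqP.
  by apply: (no_square (x := x3) (z := x2)) => //; rewrite (e_sym, eq_sym).
have p2 : e y13 x2 = false.
  apply: contraNF y1y2 => ey; apply/eqP.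
  by apply: (no_square (x := x1) (z := x2)) => //; rewrite (e_sym, eq_sym).
have p3 : e y23 x1 = false.
  apply: contraNF y1y3 => ey; apply/eqP.
  by apply: (no_square (x := x1) (z := x2)) => //; rewrite (e_sym, eq_sym).
have ns z : z \notin A -> (z \in s) = false by rewrite sA => /negbTE.
have sy (x y : T) : x != y -> ((x == y) = false) * ((y == x) = false).
  by move=> xy; rewrite (negbTE xy) eq_sym (negbTE xy).
pose E := (sy _ _ x12, sy _ _ x13, sy _ _ x23, (sy _ _ x1y1, sy _ _ x1y2, sy _ _ x1y3),
  (sy _ _ x2y1, sy _ _ x2y2, sy _ _ x2y3), (sy _ _ x3y1, sy _ _ x3y2, sy _ _ x3y3),
  (sy _ _ y1y2, sy _ _ y1y3, sy _ _ y2y3), ns _ x1A, ns _ x2A, ns _ x3A,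
  (ns _ y1A, ns _ y2A, ns _ y3A), eqxx).
have r1 : realizes (rcons s x1) (rcons g [:: ix a1]).
  apply: realizes_add => //=; rewrite -?sA ?idx // => z.
  by rewrite -sA => zA; have [[-> _ _] _] := eAz _ zA; rewrite !inE !eqi.
have r2 : realizes (rcons (rcons s x1) x2) (rcons (rcons g [:: ix a1]) [:: ix a2]).
  apply: realizes_add => //=.
  - by rewrite !(mem_rcons, inE) !E.
  - move=> z; rewrite !(mem_rcons, inE) !index_rcons => /orP[/eqP->|zs].
      by rewrite !E e_sym n12 ss (gtn_eqF (idx _ A2)).
    have zA : z \in A by rewrite sA.
    by have [[_ -> _] _] := eAz _ zA; rewrite zs !eqi.
  - by rewrite size_rcons ltnS (ltnW (idx _ A2)).
have r3 : realizes (rcons (rcons (rcons s x1) x2) x3)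
   (rcons (rcons (rcons g [:: ix a1]) [:: ix a2]) [:: ix a3]).
  apply: realizes_add => //=.
  - by rewrite !(mem_rcons, inE) !E.
  - move=> z; rewrite !(mem_rcons, inE) !index_rcons !(mem_rcons, inE).
    rewrite !size_rcons ss => /or3P[/eqP->|/eqP->|zs].
    + by rewrite !E /= e_sym n23 (gtn_eqF (leqW (idx _ A3))).
    + by rewrite !E /= e_sym n13 (gtn_eqF (idx _ A3)).
    have zA : z \in A by rewrite sA.
    by have [[_ _ ->] _] := eAz _ zA; rewrite zs orbT !eqi.
  - by rewrite !size_rcons !ltnS (leq_trans (ltnW (idx _ A3))).
set s3 := rcons (rcons _ _) _ in r3; set g3 := rcons (rcons _ _) _ in r3.
have sg3 : size g3 = (size g).+3 by rewrite !size_rcons.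
have in3 z : (z \in s3) = [|| z == x3, z == x2, z == x1 | z \in s].
  by rewrite !(mem_rcons, inE).
have ix3 : (index x1 s3 = size g) * (index x2 s3 = (size g).+1) * (index x3 s3 = (size g).+2).
  by rewrite !index_rcons !(mem_rcons, inE) !size_rcons ss !E.
have ix3s z : z \in s -> index z s3 = index z s.
  by move=> zs; rewrite !index_rcons !(mem_rcons, inE) zs !orbT.
have adds3 y l : y \notin A -> y \notin [:: x1; x2; x3] ->
    {subset l <= [:: size g; (size g).+1; (size g).+2]} ->
    e y x1 = (size g \in l) -> e y x2 = ((size g).+1 \in l) -> e y x3 = ((size g).+2 \in l) ->
    {in A, forall z, e y z = false} -> forall z, z \in s3 -> e y z = (index z s3 \in l).
  move=> yA yx sl l1 l2 l3 lA z; rewrite in3 => /or4P[/eqP->|/eqP->|/eqP->|zs].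
  - by rewrite ix3.
  - by rewrite ix3.
  - by rewrite ix3.
  rewrite lA ?sA // ix3s //; apply/esym/negP => /sl; rewrite !inE.
  have zg := index_mem_realizes rs zs.
  by rewrite (ltn_eqF zg) (ltn_eqF (leqW zg)) (ltn_eqF (leqW (leqW zg))).
have ss3 : size s3 = (size g).+3 by rewrite !size_rcons ss.
have r4 : realizes (rcons s3 y12) (rcons g3 [:: size g; (size g).+1]).
  apply: realizes_add => //=.
  - by rewrite in3 !E.
  - apply: adds3 => //; rewrite ?inE ?E //.
    + by move=> i; rewrite !inE => /orP[]->; rewrite ?orbT.
    + by rewrite e_sym.
    + by rewrite e_sym e3 orbT.
    + by rewrite p1 !(eqSS, eqS_neq).
    + by move=> z /eAz[_ []].
  - by rewrite sg3 !ltnS leqnSn -addn2 leq_addr.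
have r5 : realizes (rcons (rcons s3 y12) y13)
   (rcons (rcons g3 [:: size g; (size g).+1]) [:: size g; (size g).+2]).
  apply: realizes_add => //=.
  - by rewrite mem_rcons inE in3 !E.
  - move=> z; rewrite mem_rcons inE index_rcons => /orP[/eqP->|zs3].
      by rewrite in3 !E /= e_sym m12 ss3 !inE !(eqSS, eqS_neq).
    rewrite zs3; apply: adds3 => //; rewrite ?inE ?E //.
    + by move=> i; rewrite !inE => /orP[]->; rewrite ?orbT.
    + by rewrite e_sym.
    + by rewrite p2 !(eqSS, eqS_neq).
    + by rewrite e_sym e5 orbT.
    + by move=> z' /eAz[_ []].
  - by rewrite size_rcons sg3 !ltnS !leq_addS.
have r6 : realizes (rcons (rcons (rcons s3 y12) y13) y23)
   (rcons (rcons (rcons g3 [:: size g; (size g).+1]) [:: size g; (size g).+2])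
      [:: (size g).+1; (size g).+2]).
  apply: realizes_add => //=.
  - by rewrite !(mem_rcons, inE) !E.
  - move=> z; rewrite mem_rcons inE mem_rcons inE => /or3P[/eqP->|/eqP->|zs3].
    + rewrite index_rcons mem_rcons inE in3 !E /= size_rcons ss3 e_sym m23 !inE.
      by rewrite !(eqSS, eqS_neq).
    + rewrite index_rcons mem_rcons inE index_rcons in3 !E /= ss3 e_sym m13 !inE.
      by rewrite !(eqSS, eqS_neq).
    rewrite index_rcons mem_rcons inE index_rcons zs3 orbT.
    apply: adds3 => //; rewrite ?inE ?E //.
    + by move=> i; rewrite !inE => /orP[]->; rewrite ?orbT.
    + by rewrite p3 !(eqSS, eqS_neq).
    + by rewrite e_sym e4.
    + by rewrite e_sym e6 orbT.
    + by move=> z' /eAz[_ []].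
  - by rewrite !size_rcons !ltnS !leq_addS.
have -> : A :|: [set z in [:: x1; x2; x3; y12; y13; y23]] =
   [set x in rcons (rcons (rcons s3 y12) y13) y23].
  apply/setP => z; rewrite !(mem_rcons, inE) sA.
  by case: (z == x1); case: (z == x2); case: (z == x3);
    case: (z == y12); case: (z == y13); case: (z == y23); case: (z \in s).
apply: (ext_okP ok); move: r6.
by rewrite /g3 /ext_hex -!cats1 -!catA.
Qed.

Lemma claw_tableP g i j k (h := rcons g [:: i; j; k]) : g \in blocks ->
  i \in open_ends g -> j \in open_ends g -> k \in open_ends g -> i < j -> j < k -> sparse h ->
  [\/ find_iso (edge_graph 14 H1_edges) h, find_iso (edge_graph 20 H2_edges) h
    | greedy_size h ((size h).+1 %/ 3)].
Proof.
rewrite {}/h -[blocks]/(map fst claw_table) => /mapP[[g' known] pt /= ->] Ii Ij Ik ij jk sp.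
have := allP claw_table_ok _ pt.
move=> /allP/(_ i Ii)/allP/(_ j Ij)/allP/(_ k Ik).
rewrite ij jk /= sp; case: ifP => _; last by constructor 3.
by case/orP; [constructor 1 | constructor 2].
Qed.

Lemma realizes_graph_iso n l s h : edge_graph_ok n l -> realizes s h -> (forall x, x \in s) ->
  find_iso (edge_graph n l) h -> graph_iso e (rel_of_edges n l).
Proof.
move=> okl rs sT /find_isoP[p /is_isoP[sh sp up wp ep]].
have sn : size (edge_graph n l) = n by rewrite size_map size_iota.
rewrite sn in sh sp wp ep; have [us ss _ es] := rs.
have ix x : index x s < n by rewrite -sh -ss index_mem.
have lt x : nth 0 p (index x s) < n by rewrite wp // mem_nth ?sp.
exists (fun x => Ordinal (lt x)); split.
  apply: inj_card_bij.
    move=> x y [] /eqP; rewrite nth_uniq ?sp // => /eqP exy.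
    by rewrite -(nth_index x0 (sT x)) exy nth_index.
  by rewrite card_ord -sh -ss -(card_uniqP us) max_card.
move=> x y; rewrite /rel_of_edges /=.
have /allP/(_ (nth 0 p (index x s))) := okl; rewrite mem_iota => /(_ (lt x)).
move/allP/(_ (nth 0 p (index y s))); rewrite mem_iota => /(_ (lt y))/eqP <-.
by rewrite ep // -es ?sh // !nth_index.
Qed.

(** The three neighbours of [x] are distinct, so their sorted indices form one of the strictly
    increasing triples that [claw_ok] inspects. *)
Lemma block_claw A x a b c : block A -> (forall z, (z \in A) = (z != x)) ->
  uniq [:: a; b; c] -> (forall z, e x z = (z \in [:: a; b; c])) ->
  [\/ #|T| - 1 <= 3 * nu setT, graph_iso e H1 | graph_iso e H2].
Proof.
case=> s eA [g gB rs] Ax uabc ex.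
have sA z : (z \in A) = (z \in s) by rewrite eA inE.
have ax z : z \in [:: a; b; c] -> z \in A.
  by rewrite -ex Ax; apply: contraTneq => ->; rewrite e_irr.
pose L := sort leq [seq index z s | z <- [:: a; b; c]].
have mL z : z \in A -> (index z s \in L) = (z \in [:: a; b; c]).
  move=> zA; rewrite mem_sort; apply/mapP/idP => [[y yabc]|]; last by exists z.
  move=> exy; suff -> : z = y by [].
  by rewrite -(nth_index x0 (s := s) (x := z)) -?sA // exy nth_index // -sA ax.
have open i : i \in L -> i \in open_ends g.
  rewrite mem_sort => /mapP[z zabc ->]; apply: (index_open rs eA (v := x)).
  - by rewrite Ax eqxx.
  - exact: ax.
  - by rewrite ex.
have uL : uniq L.
  rewrite sort_uniq map_inj_in_uniq // => y z yabc zabc eyz.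
  by rewrite -(nth_index x0 (s := s) (x := y)) -?sA ?ax // eyz nth_index // -sA ax.
have oL : sorted ltn L by rewrite ltn_sorted_uniq_leq uL sort_sorted //; apply: leq_total.
have sL : size L = 3 by rewrite size_sort.
have r : realizes (rcons s x) (rcons g L).
  apply: realizes_add => //.
  - by rewrite -sA Ax eqxx.
  - by move=> z; rewrite -sA => zA; rewrite mL // ex.
  - apply/allP => i /open; rewrite mem_filter mem_iota => /andP[_ /andP[_]]; exact.
have rT z : z \in rcons s x by rewrite mem_rcons inE -sA Ax; case: eqP.
have eT : [set z in rcons s x] = setT by apply/setP => z; rewrite !inE rT.
case: L sL oL open uL mL r => [|i [|j [|k []]]] //= _ /and3P[ij jk _] open _ _ r.
have [] := claw_tableP gB (open i _) (open j _) (open k _) ij jk (realizes_sparse r);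
  rewrite ?inE ?eqxx ?orbT // => H.
- by constructor 2; apply: (realizes_graph_iso H1_graph_ok r).
- by constructor 3; apply: (realizes_graph_iso H2_graph_ok r).
constructor 1; have := realizes_greedy_size r H; rewrite eT -cardsT -eT (card_realizes r).
move: (size _) (nu _) => m v; clear; lia.
Qed.

(** * The structure of bad graphs *)

(** A vertex with a neighbour outside [A] has at most two inside. This is what puts the pieces left
    by a deletion under the induction hypothesis. *)
Lemma touching_noncubic A D : [disjoint A & D] -> 0 < eb A D -> noncubic A.
Proof.
move=> dAD /eb_gt0[x [y [xA yD exy]]]; apply/exists_inP; exists x => //.
have := dgU x dAD; have := dg_gt0 yD exy; have := dg_le3 (A :|: D) x.
move: (dg _ _) (dg _ _) (dg _ _) => p q r; clear; lia.
Qed.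

(** All edges leaving [X] in [G] end in [D], and there are at least k of them. *)
Lemma closed_eb k G D X : kconn k G -> D \subset G -> D != set0 -> X \subset G :\: D ->
  X != set0 -> eb X ((G :\: D) :\: X) = 0 -> k <= eb X D.
Proof.
move=> /kconnP[_ kG] DG D0; rewrite subsetD => /andP[XG dXD] X0 eX.
have XnG : X != G.
  apply: contraNneq D0 => XG'; rewrite -subset0 -(setDv G) -{2}XG'.
  by rewrite subsetD DG disjoint_sym.
apply: leq_trans (kG X XG X0 XnG) _.
rewrite (eb_splitr X (A := D)); last by rewrite subsetD DG disjoint_sym.
suff -> : (G :\: X) :\: D = (G :\: D) :\: X by rewrite eX addn0.
by rewrite !setDDl setUC.
Qed.

Lemma comp_eb k G D A : kconn k G -> D \subset G -> D != set0 -> A \in comps (G :\: D) ->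
  k <= eb A D.
Proof.
by move=> kG DG D0 /compsP[AS /andP[A0 _] eA]; apply: (closed_eb kG).
Qed.

Lemma badc_bad G D A : kconn 1 G -> D \subset G -> D != set0 -> A \in badc (G :\: D) -> bad A.
Proof.
move=> kG DG D0; rewrite inE => /andP[cA bA]; have eA := comp_eb kG DG D0 cA.
have /compsP[AS kA _] := cA; rewrite /bad kA bA andbT; apply: touching_noncubic eA.
by move: AS; rewrite subsetD => /andP[].
Qed.

Definition bounded N := forall S, #|S| < N -> kconn 1 S -> noncubic S -> #|S| <= 3 * nu S + 1.

(** Each component that is left sends at least k edges to [D]. Hence it is noncubic, has f at most
    1, and the edges at [D] limit how many components can be bad. *)
Lemma delete_bound N k G D : bounded N -> 0 < k -> kconn k G -> D \subset G -> D != set0 ->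
  #|G :\: D| < N ->
  #|G :\: D| <= 3 * nu (G :\: D) + #|badc (G :\: D)| /\
  #|badc (G :\: D)| * k <= eb (G :\: D) D.
Proof.
move=> bN k0 kG DG D0 ltN; split.
  apply: (card_le_nu_badc) => A cA; have /compsP[AS kA _] := cA.
  apply: bN => //; first exact: leq_ltn_trans (subset_leq_card AS) ltN.
  apply: (touching_noncubic (D := D)); first by move: AS; rewrite subsetD => /andP[].
  exact: leq_trans k0 (comp_eb kG DG D0 cA).
have bs := badc_sub (G :\: D).
apply: leq_trans (ebSl D (cover_comps bs)); rewrite -(sum_eb_comps _ bs).
rewrite -sum_nat_const; apply: leq_sum => A /(subsetP bs); exact: comp_eb.
Qed.

(** Anything left besides [F] would itself send at least k edges to [D], more than remain. *)
Lemma rest_empty k G D F : kconn k G -> D \subset G -> D != set0 -> F \subset comps (G :\: D) ->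
  eb (G :\: D) D < eb (cover F) D + k -> G :\: D = cover F.
Proof.
move=> kG DG D0 FS; have cS := cover_comps FS.
rewrite (eb_splitl D cS) ltn_add2l ltnNge => lt; apply/eqP; rewrite eqEsubset cS andbT.
rewrite -setD_eq0; apply: contraNT lt => X0; apply: (closed_eb kG DG D0 _ X0).
  exact: subsetDl.
have -> : (G :\: D) :\: ((G :\: D) :\: cover F) = cover F by rewrite setDDr setDv set0U (setIidPr cS).
exact: cover_closed.
Qed.

Lemma dgD1 S x : dg (S :\ x) x = dg S x.
Proof.
have [xS|xS] := boolP (x \in S).
  by rewrite (dg_split (S := S) x (A := [set x])) ?sub1set // dg_set1 e_irr.
by congr dg; apply/setDidPl; rewrite disjoints_subset subsetC sub1set inE.
Qed.

(* Deleting [r] leaves at most two components, and |P| - 1 is divisible by 3. *)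
Lemma bad_delete1 N P r : bounded N -> #|P| < N -> bad P -> r \in P -> dg P r <= 2 ->
  #|P :\ r| <= 3 * nu (P :\ r).
Proof.
move=> bN ltN /and3P[kP ncP bP] rP dr.
have leP := bN P ltN kP ncP; have cP := cardsD1 r P; rewrite rP in cP.
have r0 : [set r] != set0 by apply/set0Pn; exists r; rewrite inE.
have lt : #|P :\ r| < N by rewrite (leq_trans _ ltN) // ltnS cP leq_addl.
have rs : [set r] \subset P by rewrite sub1set.
have [le1 le2] := delete_bound bN (ltn0Sn 0) kP rs r0 lt.
move: le2; rewrite (eb_set1r) dgD1 => le2.
move: cP leP bP le1 le2 dr.
move: #|_| #|_| #|_| (nu _) (nu _) (dg _ _) => p q r' s t d; clear; lia.
Qed.

(* Three bad graphs, each joined by one edge to a new vertex [j]. *)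
Definition triple_join S : Prop := exists j A1 A2 A3,
  [/\ j \in S, S :\ j = A1 :|: A2 :|: A3, [/\ bad A1, bad A2 & bad A3],
      [/\ [disjoint A1 & A2], [disjoint A1 & A3] & [disjoint A2 & A3]] &
      [/\ dg A1 j = 1, dg A2 j = 1 & dg A3 j = 1] /\
      [/\ eb A1 (S :\: A1) = 1, eb A2 (S :\: A2) = 1 & eb A3 (S :\: A3) = 1]].

Definition shape S : Prop := [\/ #|S| = 1, triple_join S | kconn 2 S /\ block S].

(** For bad [S] this says that deleting [p] and [q] does not lower nu: some maximum uniquely
    restricted matching avoids both. *)
Definition deletable2 S : Prop := forall p q, p \in S -> q \in S -> p != q ->
  dg S p <= 2 -> dg S q <= 2 -> #|S| <= 3 * nu (S :\: [set p; q]) + 1.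

Definition described N := forall S, #|S| < N -> bad S ->
  shape S /\ (kconn 2 S -> deletable2 S).

(** * Small edge cuts in bridgeless graphs *)

Lemma outer_edges G S A : kconn 2 G -> S \subset G -> A \subset S -> A != set0 -> A != S ->
  eb A (S :\: A) = 1 -> eb A (G :\: A) = (eb A (G :\: S)).+1 /\ 0 < eb A (G :\: S).
Proof.
move=> /kconnP[_ kG] SG AS A0 AnS eA.
have AnG : A != G by apply: contraNneq AnS => AG; rewrite eqEsubset AS AG.
have := kG A (subset_trans AS SG) A0 AnG.
have -> : eb A (G :\: A) = (eb A (G :\: S)).+1; last by [].
rewrite (eb_splitr _ (setSD A SG)) eA add1n; congr (eb _ _).+1.
by rewrite setDDl setUD_id.
Qed.

(** Each part has a single edge within [S], which would be a bridge of [G] unless another edge leads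
    from the part out of [S]. *)
Lemma triple_join_parts G S j A1 A2 A3 : kconn 2 G -> S \subset G -> j \in S ->
  S :\ j = A1 :|: A2 :|: A3 -> [/\ bad A1, bad A2 & bad A3] ->
  [/\ [disjoint A1 & A2], [disjoint A1 & A3] & [disjoint A2 & A3]] ->
  [/\ eb A1 (S :\: A1) = 1, eb A2 (S :\: A2) = 1 & eb A3 (S :\: A3) = 1] ->
  [/\ forall A, A \in [:: A1; A2; A3] ->
        [/\ A \subset S :\ j, eb A (G :\: A) = (eb A (G :\: S)).+1 & 0 < eb A (G :\: S)] &
      eb S (G :\: S) = dg (G :\: S) j + eb A1 (G :\: S) + eb A2 (G :\: S) + eb A3 (G :\: S)].
Proof.
move=> kG SG jS eS [b1 b2 b3] [d12 d13 d23] [e1 e2 e3]; split.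
  have part A : A \subset S :\ j -> bad A -> eb A (S :\: A) = 1 ->
      [/\ A \subset S :\ j, eb A (G :\: A) = (eb A (G :\: S)).+1 & 0 < eb A (G :\: S)].
    move=> As /and3P[/andP[A0 _] _ _] eA.
    have AnS : A != S.
      by apply: contraTneq As => ->; apply/negP => /subsetP/(_ j jS); rewrite !inE eqxx.
    have [] := outer_edges kG SG (subset_trans As (subsetDl _ _)) A0 AnS eA; by split.
  move=> A; rewrite !inE => /or3P[]/eqP->; apply: part => //; rewrite eS.
  - by rewrite -setUA subsetUl.
  - by rewrite setUAC subsetUr.
  - exact: subsetUr.
rewrite (eb_D1l _ jS) eS !ebUl // ?addnA //.
by rewrite -setI_eq0 setIUl (disjoint_setI0 d13) (disjoint_setI0 d23) setU0.
Qed.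

(** A triple join is impossible, as its three parts need three edges leaving [C]. Otherwise [C] can
    spare both vertices at the cut by [deletable2], so one of them can be matched across the cut at
    no cost inside [C]. *)
Lemma two_edge_cut N G C : bounded N -> described N -> #|G| <= N -> kconn 2 G ->
  C \subset G -> C != G -> bad C -> eb C (G :\: C) <= 2 -> #|C| = 1 \/ #|G| <= 3 * nu G.
Proof.
move=> bN dN GN kG CG CnG bC eC2.
have cG := cards_split CG; set R := G :\: C in cG eC2 *.
have CltN : #|C| < N.
  by apply: leq_trans GN; apply: proper_card; rewrite properEneq CnG.
have [sC delC] := dN C CltN bC; case: sC => [|tj|[kC _]]; [by left| |].
  have [j [A1 [A2 [A3 [jC eS bs ds [_ es]]]]]] := tj.
  have [part sum] := triple_join_parts kG CG jC eS bs ds es.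
  have [_ _ p1] := part A1 (mem_head _ _).
  have [_ _ p2] : [/\ A2 \subset C :\ j, eb A2 (G :\: A2) = (eb A2 R).+1 & 0 < eb A2 R].
    by apply: part; rewrite !inE eqxx orbT.
  have [_ _ p3] : [/\ A3 \subset C :\ j, eb A3 (G :\: A3) = (eb A3 R).+1 & 0 < eb A3 R].
    by apply: part; rewrite !inE eqxx !orbT.
  move: eC2 p1 p2 p3; rewrite sum -/R; move: (dg _ _) (eb _ _) (eb _ _) (eb _ _) => p q r t.
  clear; lia.
have [C1|C1] := leqP #|C| 1.
  left; apply/eqP; rewrite eqn_leq C1 card_gt0; by case/andP: kC.
right; have [kC1 ncC ltC] := and3P bC.
have leC := bN C CltN kC1 ncC.
have dCR p : p \in C -> dg C p + dg R p <= 3.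
  by move=> pC; rewrite -dgU ?disjointDr // setUD_id // dg_le3.
have dC2 p : p \in C -> 2 <= dg C p by move=> pC; apply: (kconn_dg kC).
(* A vertex of [C] has two neighbours in [C], hence at most one outside: the cut edges have distinct
   ends in [C]. *)
have eR : eb C R = #|[set p in C | 0 < dg R p]|.
  rewrite -sum1_card [RHS](eq_bigl (fun p => (p \in C) && (0 < dg R p))); last first.
    by move=> p; rewrite inE.
  rewrite [RHS]big_mkcondr /eb; apply: eq_bigr => p pC; have := dCR p pC; have := dC2 p pC.
  by case: (dg R p) => [|[|m]] //; move: (dg _ _) => q; clear; lia.
have C0 : C != set0 by case/andP: kC.
have eC : eb C R = 2.
  by apply/eqP; rewrite eqn_leq eC2 /=; case/kconnP: kG => _; apply.
move: eR; rewrite eC => /esym/eqP/cards2P[p1 [p2 [p12 eX]]].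
have inX p : (p \in C) && (0 < dg R p) = (p == p1) || (p == p2).
  by move/setP/(_ p): eX; rewrite !inE.
have /andP[p1C d1] : (p1 \in C) && (0 < dg R p1) by rewrite inX eqxx.
have /andP[p2C d2] : (p2 \in C) && (0 < dg R p2) by rewrite inX eqxx orbT.
have dC p : p \in C -> 0 < dg R p -> dg C p <= 2.
  by move=> /dCR; move: (dg _ _) (dg _ _) => a b; clear; lia.
have del := delC kC p1 p2 p1C p2C p12 (dC _ p1C d1) (dC _ p2C d2).
have [p [q1 [pp q1R e1]]] : exists x y, [/\ x \in [set p1], y \in R & e x y].
  by apply: eb_gt0; rewrite eb_set1l.
move: pp; rewrite inE => /eqP ?; subst p.
have RG : R \subset G by apply: subsetDl.
have CR : [disjoint C & R] by apply: disjointDr.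
have q1C : q1 \notin C by move: q1R; rewrite inE => /andP[].
have p1R : p1 \notin R by rewrite inE p1C.
(* [C - p1 - p2] and [R + p1] meet only through [p1] *)
have nu1 : nu (C :\: [set p1; p2]) + nu (p1 |: R) <= nu G.
  apply: leq_trans (nu_union (b := p1) _ _) (nuS _).
  - rewrite -setI_eq0; apply/eqP/setP => z; rewrite !inE.
    by case: (z == p1); case: (z \in C); rewrite ?andbF.
  - move=> x y; rewrite !inE negb_or => /andP[/andP[xp1 xp2] xC] /orP[/eqP->|yR]; first by rewrite eqxx orbT.
    move=> exy; have := inX x; rewrite xC (negbTE xp1) (negbTE xp2) (dg_gt0 _ exy) //.
    by rewrite !inE.
  - rewrite !subUset sub1set (subsetP CG) // RG andbT.
    by rewrite (subset_trans (subsetDl _ _)).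
have dR1 : dg R p1 = 1.
  have := dCR p1 p1C; have := dC2 p1 p1C; move: d1; move: (dg _ _) (dg _ _) => a b.
  clear; lia.
have nu2 : (nu (R :\ q1)).+1 <= nu (p1 |: R).
  apply: leq_ltn_trans (nu_peel (u := p1) (v := q1) _ _ _) => //.
  - apply: nuS => //; apply/subsetP => z; rewrite !inE => /andP[zq1 /andP[zC zG]].
    have zR : z \in R by rewrite inE zC.
    have zp1 : z != p1 by apply: contraNneq zC => ->.
    rewrite negb_or zp1 zC zG orbT andbT /=.
    apply/negP => e1z; suff : 1 < dg R p1 by rewrite dR1.
    have <- : #|[set z; q1]| = 2 by rewrite cards2 zq1.
    apply: subset_leq_card.
    by apply/subsetP => t; rewrite in_set2 inE => /orP[]/eqP->; rewrite ?zR ?q1R ?e1 ?e1z.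
  - by rewrite !inE eqxx.
  - by rewrite in_setU q1R orbT.
have DE : R :\ q1 = G :\: (C :|: [set q1]) by rewrite setDDl.
have qG : q1 \in G by apply: (subsetP RG).
have DG : C :|: [set q1] \subset G by rewrite subUset CG sub1set.
have D0 : C :|: [set q1] != set0 by apply/set0Pn; exists q1; rewrite !inE eqxx orbT.
have cR := cardsD1 q1 R; rewrite q1R in cR.
have ltR : #|G :\: (C :|: [set q1])| < N.
  apply: leq_trans GN; rewrite -DE cG cR; move: (#|_|) C0 (#|_|) => a; rewrite -card_gt0.
  move: #|_| => b; clear; lia.
have [le1 le2] := delete_bound bN (ltn0Sn 1) kG DG D0 ltR.
move: le1 le2; rewrite -DE => le1.
rewrite (ebUr); last first.
  by rewrite disjoint_sym disjoints_subset sub1set inE.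
rewrite (eb_set1r) dgD1 => le2.
have h1 : dg R q1 + dg C q1 <= 3.
  by rewrite addnC -dgU ?disjointDr // setUD_id // dg_le3.
have h2 : 0 < dg C q1 by apply: (dg_gt0 p1C); rewrite e_sym.
have h3 : dg C q1 + eb (R :\ q1) C = 2 by rewrite -eb_D1l // -ebC.
(* At most three edges run from [R :\ q1] to [C] and [q1], and a bad component takes two, so at most
   one is bad: |R| - 1 <= 3 nu(R - q1) + 1. With [del] the total deficit is 3, which the edge from
   [p1] to [q1] makes up. *)
move: cG cR le1 le2 h1 h2 h3 nu1 nu2 del ltC leC; clear.
move: #|_| #|_| #|_| #|_| #|_| (nu _) (nu _) (nu _) (nu _) (nu _) (dg _ _) (dg _ _) (eb _ _).
lia.
Qed.

Lemma dg_set2 u v x : u != v -> dg [set u; v] x = e x u + e x v.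
Proof.
by move=> uv; rewrite (dgU) ?dg_set1 // disjoints_subset sub1set !inE.
Qed.

Lemma dg_set3 u v w x : u != v -> u != w -> v != w -> dg [set u; v; w] x = e x u + e x v + e x w.
Proof.
move=> uv uw vw; rewrite (dgU) ?dg_set1 ?dg_set2 //.
by rewrite disjoints_subset subUset !sub1set !inE uw vw.
Qed.

Lemma eb_comp G D A : D \subset G -> A \in comps (G :\: D) -> eb A (G :\: A) = eb A D.
Proof.
move=> DG /compsP[]; rewrite subsetD => /andP[AG dAD] _ e0.
rewrite (eb_splitr A (A := D)) ?subsetD ?DG 1?disjoint_sym //.
by rewrite setDDl setUC -setDDl e0 addn0.
Qed.

Lemma badc_proper G D A : D \subset G -> D != set0 -> A \in badc (G :\: D) ->
  [/\ A \in comps (G :\: D), A \subset G & A != G].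
Proof.
move=> DG D0; rewrite inE => /andP[cA _]; have /compsP[AS _ _] := cA; split=> //.
  exact: subset_trans AS (subsetDl _ _).
apply: contraNneq D0 => AG; rewrite -subset0 -(setDv G) -{2}AG.
by move: AS; rewrite !subsetD DG disjoint_sym => /andP[].
Qed.

Lemma eb_badc2 G D A B : A != B -> A \in badc (G :\: D) -> B \in badc (G :\: D) ->
  eb A D + eb B D <= eb (G :\: D) D.
Proof.
move=> AB bA bB; have bs := subsetP (badc_sub (G :\: D)).
have cA := bs _ bA; have cB := bs _ bB.
rewrite -ebUl; last exact: comps_disjoint cA cB AB.
by apply: ebSl; rewrite subUset; have /compsP[-> _ _] := cA; have /compsP[-> _ _] := cB.
Qed.

(** At most four edges meet [p] and [q], so at most two components left are bad. If there are two,
    each has exactly two edges, is a single vertex by [two_edge_cut], and is adjacent to both [p]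
    and [q]: a 4-cycle. *)
Lemma bad_deletable2 N P : bounded N -> described N -> #|P| <= N -> #|P| <= 3 * nu P + 1 ->
  bad P -> kconn 2 P -> deletable2 P.
Proof.
move=> bN dN PN leP bP kP p q pP qP pq dp dq.
pose D := [set p; q]; rewrite -/D.
have DP : D \subset P by rewrite subUset !sub1set pP.
have D0 : D != set0 by apply/set0Pn; exists p; rewrite !inE eqxx.
have cP := cards_split DP; rewrite cards2 pq in cP.
have ltN : #|P :\: D| < N by apply: leq_trans PN; rewrite cP; clear; lia.
have [le1 le2] := delete_bound bN (ltn0Sn 1) kP DP D0 ltN.
have /and3P[kP1 _ ltP] := bP.
have leD : eb (P :\: D) D <= 4.
  rewrite ebC /D (eb_D1l _ (x := p)) ?inE ?eqxx // (_ : _ :\ p = [set q]); last first.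
    by apply/setP => z; rewrite !inE; case: eqP => // ->; rewrite (negbTE pq).
  rewrite eb_set1l; apply: (@leq_add _ _ 2 2).
    by apply: leq_trans dp; apply: (dgS); apply: subsetDl.
  by apply: leq_trans dq; apply: (dgS); apply: subsetDl.
(* One bad component gives |P| <= 3 nu(P - p - q) + 3; as |P| is 1 modulo 3, the 3 improves to 1. *)
have [b1|b2] := leqP #|badc (P :\: D)| 1.
  move: b1 le1 cP leP ltP; clear; move: #|_| #|_| #|_| (nu _) (nu _) => a b c n m; lia.
have /cards2P[A [B [AB eAB]]] : #|badc (P :\: D)| == 2.
  by move: b2 le2 leD; move: #|_| (eb _ _) => a b; clear; lia.
have bA : A \in badc (P :\: D) by rewrite eAB !inE eqxx.
have bB : B \in badc (P :\: D) by rewrite eAB !inE eqxx orbT.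
have le4 := leq_trans (eb_badc2 AB bA bB) leD.
have single X : X \in badc (P :\: D) -> eb X D <= 2 ->
    exists c, [/\ X = [set c], e c p & e c q].
  move=> bX leX; have [cX XP XnP] := badc_proper DP D0 bX.
  have badX := badc_bad kP1 DP D0 bX.
  have := two_edge_cut bN dN PN kP XP XnP badX; rewrite (eb_comp DP cX) => /(_ leX)[].
    move/eqP/cards1P=> [c eX]; exists c.
    have := comp_eb kP DP D0 cX; rewrite eX eb_set1l dg_set2 //.
    by case: (e c p); case: (e c q).
  by move: ltP; move: #|_| (nu _) => a b; clear; lia.
have ge2 X : X \in badc (P :\: D) -> 2 <= eb X D.
  by move=> /(badc_proper DP D0)[cX _ _]; apply: comp_eb kP DP D0 cX.
have [a [eA ap aq]] : exists c, [/\ A = [set c], e c p & e c q].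
  apply: single => //; have := ge2 B bB; move: le4; move: (eb _ _) (eb _ _) => s t; clear; lia.
have [b [eB bp bq]] : exists c, [/\ B = [set c], e c p & e c q].
  apply: single => //; have := ge2 A bA; move: le4; move: (eb _ _) (eb _ _) => s t; clear; lia.
have ab : a = b.
  by apply: (no_square (x := p) (z := q)) => //; rewrite e_sym.
by move: AB; rewrite eA eB ab eqxx.
Qed.

(** * Graphs with a bridge *)

(** If [A] were disconnected, both pieces would need an edge to the other side of the bridge. *)
Lemma bridge_half G A : kconn 1 G -> A \subset G -> A != set0 -> eb A (G :\: A) = 1 ->
  kconn 1 A /\ noncubic A.
Proof.
move=> /kconnP[_ kG] AG A0 eA; split; last first.
  by apply: (touching_noncubic (D := G :\: A)); rewrite ?disjointDr ?eA.
apply/kconnP; split=> // X XA X0 XnA.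
rewrite lt0n; apply/negP => /eqP eX.
have XG := subset_trans XA AG.
have out (Y : {set T}) : Y \subset A -> Y != set0 -> Y != A -> eb Y (A :\: Y) = 0 -> 0 < eb Y (G :\: A).
  move=> YA Y0 YnA eY.
  have YnG : Y != G by apply: contraNneq YnA => YG; rewrite eqEsubset YA YG.
  apply: leq_trans (kG Y (subset_trans YA AG) Y0 YnG) _.
  rewrite (eb_splitr _ (setSD Y AG)) eY add0n setDDl setUD_id //.
have AX : A :\: (A :\: X) = X by rewrite setDDr setDv set0U (setIidPr XA).
have h1 := out X XA X0 XnA eX.
have h2 : 0 < eb (A :\: X) (G :\: A).
  apply: out; rewrite ?subsetDl ?AX 1?ebC //.
    by rewrite setD_eq0; apply: contraNN XnA => AX'; rewrite eqEsubset XA.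
  by apply: contraNneq X0 => AX'; rewrite -AX AX' setDv.
have := eA; rewrite (eb_splitl _ XA).
by move: h1 h2; move: (eb _ _) (eb _ _) => s t; clear; lia.
Qed.

Lemma eb_card A B : eb A B = #|[set p : T * T | [&& p.1 \in A, p.2 \in B & e p.1 p.2]]|.
Proof.
rewrite /eb (eq_bigr (fun x => \sum_(y in B) e x y)) => [|x _]; last exact: dgE.
rewrite pair_big /= -sum1_card big_mkcond [RHS]big_mkcond /=; apply: eq_bigr => p _.
by rewrite inE; case: (_ \in A); case: (_ \in B); case: (e _ _).
Qed.

Lemma eb_eq1 A B : eb A B = 1 -> exists a b, [/\ a \in A, b \in B, e a b &
  forall x y, x \in A -> y \in B -> e x y -> x = a /\ y = b].
Proof.
rewrite eb_card => /eqP/cards1P[[a b] eP]; exists a, b.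
have inP x y : [&& x \in A, y \in B & e x y] = (x == a) && (y == b).
  by have /setP/(_ (x, y)) := eP; rewrite !inE xpair_eqE.
have /and3P[aA bB eab] : [&& a \in A, b \in B & e a b] by rewrite inP !eqxx.
split=> // x y xA yB exy; have := inP x y; rewrite xA yB exy.
by move/esym/andP=> [/eqP-> /eqP->].
Qed.

(* Since [a] can be spared in [A], the bad side acts like a single pendant vertex
   at [b]; matching it to [b] gains unless [b] separates two further bad parts. *)
Lemma bridge_join N G A : bounded N -> #|G| <= N -> kconn 1 G -> A \subset G -> A != set0 ->
  A != G -> eb A (G :\: A) = 1 -> bad A ->
  #|G| <= 3 * nu G + 1 /\ (#|G| <= 3 * nu G \/ triple_join G).
Proof.
move=> bN GN kG AG A0 AnG eA bA; set B := G :\: A in eA *.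
have BG : B \subset G by apply: subsetDl.
have GB : G :\: B = A by rewrite setDDr setDv set0U (setIidPr AG).
have B0 : B != set0 by rewrite setD_eq0; apply: contraNN AnG => GA; rewrite eqEsubset AG.
have eB : eb B (G :\: B) = 1 by rewrite GB ebC.
have [kB ncB] := bridge_half kG BG B0 eB.
have [a [b [aA bB eab only]]] := eb_eq1 eA.
have dAB : [disjoint A & B] by apply: disjointDr.
have cG := cards_split AG; rewrite -/B in cG.
have A1 : 0 < #|A| by rewrite card_gt0.
have B1 : 0 < #|B| by rewrite card_gt0.
have ltA : #|A| < N by apply: leq_trans GN; move: cG B1; clear; move: #|_| #|_| #|_|; lia.
have ltB : #|B| < N by apply: leq_trans GN; move: cG A1; clear; move: #|_| #|_| #|_|; lia.
have bA' : b \notin A by move: bB; rewrite inE => /andP[].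
have aB' : a \notin B by rewrite inE aA.
have dBa : dg B a = 1.
  have := eA; rewrite (eb_D1l _ aA).
  have : 0 < dg B a by apply: dg_gt0 eab.
  by move: (dg _ _) (eb _ _) => s t; clear; lia.
have dAb : dg A b = 1.
  have := eA; rewrite ebC (eb_D1l _ bB).
  have : 0 < dg A b by apply: dg_gt0 aA _; rewrite e_sym.
  by move: (dg _ _) (eb _ _) => s t; clear; lia.
have da2 : dg A a <= 2.
  have := dg_le3 G a; rewrite (dg_split _ AG) dBa.
  by move: (dg _ _) => s; clear; lia.
have db2 : dg B b <= 2.
  have := dg_le3 G b; rewrite (dg_split _ AG) dAb.
  by move: (dg _ _) => s; clear; lia.
have le1 := bad_delete1 bN ltA bA aA da2.
(* The bridge is the only edge between [A] and [B], so all edges between these two sets contain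
   [a]. *)
have nu1 : nu (A :\ a) + nu (a |: B) <= nu G.
  apply: leq_trans (nu_union (b := a) _ _) (nuS _).
  - rewrite -setI_eq0; apply/eqP/setP => z; rewrite !inE.
    by case: (z == a); case: (z \in A); rewrite ?andbF.
  - move=> x y; rewrite !inE => /andP[xa xA] /orP[/eqP->|yB]; first by rewrite eqxx orbT.
    have yB' : y \in B by rewrite inE.
    by move=> exy; have [xa' _] := only x y xA yB' exy; rewrite xa' eqxx in xa.
  - rewrite !subUset sub1set (subsetP AG) // BG andbT.
    by rewrite (subset_trans (subsetDl _ _) AG).
have nu2 : (nu (B :\ b)).+1 <= nu (a |: B).
  apply: leq_ltn_trans (nu_peel (u := a) (v := b) _ _ _) => //.
  - apply: nuS => //; apply/subsetP => z; rewrite in_setD1 => /andP[zb zB].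
    rewrite !inE negb_or; have := zB; rewrite inE => ->; rewrite orbT andbT.
    apply/andP; split; first by apply: contraNneq aB' => <-.
    by apply/negP => eaz; have [_ zb'] := only a z aA zB eaz; rewrite zb' eqxx in zb.
  - by rewrite !inE eqxx.
  - by rewrite in_setU bB orbT.
have b0 : [set b] != set0 by apply/set0Pn; exists b; rewrite inE.
have bsB : [set b] \subset B by rewrite sub1set.
have cB := cardsD1 b B; rewrite bB in cB.
have cA := cardsD1 a A; rewrite aA in cA.
have ltBb : #|B :\ b| < N by apply: ltn_trans ltB; rewrite cB.
have [le2 le3] := delete_bound bN (ltn0Sn 0) kB bsB b0 ltBb.
move: le3; rewrite (eb_set1r) dgD1 => le3.
split.
  move: cG cA cB le1 le2 le3 nu1 nu2 db2; clear.
  move: #|_| #|_| #|_| #|_| #|_| #|_| (nu _) (nu _) (nu _) (nu _) (dg _ _); lia.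
have [bc1|bc2] := leqP #|badc (B :\ b)| 1.
  left; move: cG cA cB le1 le2 le3 nu1 nu2 bc1; clear.
  move: #|_| #|_| #|_| #|_| #|_| #|_| (nu _) (nu _) (nu _) (nu _) (dg _ _); lia.
have /cards2P[X [Y [XY eXY]]] : #|badc (B :\ b)| == 2.
  by move: bc2 le3 db2; move: #|_| (dg _ _) => s t; clear; lia.
right; exists b, A, X, Y.
have bX : X \in badc (B :\ b) by rewrite eXY !inE eqxx.
have bY : Y \in badc (B :\ b) by rewrite eXY !inE eqxx orbT.
have [cX XB XnB] := badc_proper bsB b0 bX.
have [cY YB YnB] := badc_proper bsB b0 bY.
have XY0 : eb X [set b] + eb Y [set b] <= 2.
  by apply: leq_trans (eb_badc2 XY bX bY) _; rewrite (eb_set1r) dgD1.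
have [eX eY] : eb X [set b] = 1 /\ eb Y [set b] = 1.
  have := comp_eb kB bsB b0 cX; have := comp_eb kB bsB b0 cY; move: XY0.
  by move: (eb _ _) (eb _ _) => s t; clear; lia.
have cover_badc : cover (badc (B :\ b)) = X :|: Y.
  by rewrite eXY /cover big_setU1 ?inE //= big_set1.
have dXY : [disjoint X & Y] by apply: comps_disjoint cX cY XY.
(* The two bad parts already take both edges that [b] has inside [B]. *)
have eB' : B :\ b = X :|: Y.
  rewrite -cover_badc; apply: (rest_empty kB bsB b0 (badc_sub _)).
  by rewrite cover_badc ebUl // eX eY (eb_set1r) dgD1.
have GDb : G :\ b = A :|: X :|: Y.
  rewrite -setUA -eB'; apply/setP => z; rewrite !inE.
  case: eqP => [->|_] /=; first by rewrite (negbTE bA') .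
  by case: (z \in A) (subsetP AG z) => // /(_ isT).
have dAX : [disjoint A & X].
  by apply: disjointWr dAB.
have dAY : [disjoint A & Y].
  by apply: disjointWr dAB.
have eAZ (Z : {set T}) : Z \subset B :\ b -> eb Z A = 0.
  move=> ZB; apply/eqP/eb_eq0 => z x zZ xA; apply/negP => ezx.
  have := subsetP ZB _ zZ; rewrite in_setD1 => /andP[zb zB].
  have exz : e x z by rewrite e_sym.
  by have [_ zb'] := only x z xA zB exz; rewrite zb' eqxx in zb.
have eout (Z : {set T}) : Z \in badc (B :\ b) -> eb Z [set b] = 1 -> eb Z (G :\: Z) = 1.
  move=> bZ eZ; have [cZ ZB ZnB] := badc_proper bsB b0 bZ.
  have /compsP[ZBb _ _] := cZ.
  have -> : G :\: Z = A :|: (B :\: Z).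
    apply/setP => z; rewrite !inE; have := subsetP ZB z; rewrite inE.
    by case: (z \in Z) => [/(_ isT)/andP[/negbTE->]|_] //; case: (z \in A) (subsetP AG z) => // /(_ isT).
  rewrite (ebUr) ?eAZ ?(eb_comp bsB) //.
  by apply: disjointWr dAB; apply: subsetDl.
split=> //.
- exact: (subsetP BG).
- by split=> //; apply: (badc_bad kB bsB b0).
- by split; [rewrite dAb -!(eb_set1r) | split=> //; apply: eout].
Qed.

(** If neither side is bad, the matchings of the two sides combine, the bridge being the only
    crossing edge; otherwise a bad side goes to [bridge_join]. *)
Lemma bridge_case N G : bounded N -> #|G| <= N -> kconn 1 G -> ~~ kconn 2 G ->
  #|G| <= 3 * nu G + 1 /\ (#|G| <= 3 * nu G \/ triple_join G).
Proof.
move=> bN GN kG nkG; have [G0 kG'] := kconnP _ _ kG.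
have [A [AG A0 AnG eA]] : exists A, [/\ A \subset G, A != set0, A != G & eb A (G :\: A) = 1].
  move: nkG; rewrite /kconn G0 negb_forall => /existsP[A]; rewrite negb_imply -ltnNge.
  case/andP=> /and3P[AG A0 AnG] eA; exists A; split=> //.
  by have := kG' A AG A0 AnG; move: eA; move: (eb _ _) => s; clear; lia.
have [bA|nbA] := boolP (bad A); first exact: (bridge_join bN GN kG AG A0 AnG).
set B := G :\: A in eA.
have BG : B \subset G by apply: subsetDl.
have GB : G :\: B = A by rewrite setDDr setDv set0U (setIidPr AG).
have B0 : B != set0 by rewrite setD_eq0; apply: contraNN AnG => GA; rewrite eqEsubset AG.
have BnG : B != G by apply: contraNneq A0 => BG'; rewrite -GB BG' setDv.
have eB : eb B (G :\: B) = 1 by rewrite GB ebC.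
have [bB|nbB] := boolP (bad B); first exact: (bridge_join bN GN kG BG B0 BnG).
have [kA ncA] := bridge_half kG AG A0 eA; have [kB ncB] := bridge_half kG BG B0 eB.
move: nbA nbB; rewrite /bad kA ncA kB ncB /= -!leqNgt => leA leB.
have [a [b [aA bB eab only]]] := eb_eq1 eA.
have := nu_union (b := a) (disjointDr A G).
have onlya x y : x \in A -> y \in G :\: A -> e x y -> (x == a) || (y == a).
  by move=> xA yB exy; have [-> _] := only x y xA yB exy; rewrite eqxx.
move=> /(_ onlya); rewrite setUD_id // -/B => leG.
suff : #|G| <= 3 * nu G by move=> H; split; [exact: leq_trans H (leq_addr _ _) | left].
have := cards_split AG; rewrite -/B.
by move: leA leB leG; move: #|_| #|_| #|_| (nu _) (nu _) (nu _) => p q r s t u'; clear; lia.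
Qed.

(** * Bridgeless noncubic graphs *)

Lemma dg_eq1 A x : dg A x = 1 -> exists a, a \in A /\ {in A, forall z, e x z = (z == a)}.
Proof.
move/eqP/cards1P=> [a ea]; have inA z : (z \in A) && e x z = (z == a).
  by have /setP/(_ z) := ea; rewrite !inE.
exists a; split; first by have := inA a; rewrite eqxx => /andP[].
by move=> z zA; rewrite -inA zA.
Qed.

Lemma dg_two_ends A x : 0 < dg A x -> dg A x <= 2 -> exists a b, two_ends A x a b.
Proof.
move=> d0 d2; have [d1|dn1] := eqVneq (dg A x) 1.
  by have [a [aA ea]] := dg_eq1 d1; exists a, a; split=> // z zA; rewrite orbb ea.
have /cards2P[a [b [_ eab]]] : dg A x == 2.
  by move: d0 d2 dn1; move: (dg _ _) => s; clear; lia.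
have inA z : (z \in A) && e x z = (z == a) || (z == b).
  by have /setP/(_ z) := eab; rewrite !inE.
exists a, b; split.
- by have := inA a; rewrite eqxx => /andP[].
- by have := inA b; rewrite eqxx orbT => /andP[].
- by move=> z zA; rewrite -inA zA.
Qed.

Lemma claw_modelled A j q1 q2 q3 : A :\ j = [set q1; q2; q3] -> j \in A ->
  uniq [:: q1; q2; q3] -> [/\ e j q1, e j q2 & e j q3] -> modelled [:: K13] A.
Proof.
move=> eA jA uq [e1 e2 e3].
have qA q : q \in [:: q1; q2; q3] -> q != j.
  move=> qq; have : q \in A :\ j by rewrite eA !inE orbA in qq *.
  by rewrite in_setD1 => /andP[].
exists [:: j; q1; q2; q3].
  apply/setP => z; rewrite !inE; have /setP/(_ z) := eA; rewrite !inE.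
  by case: eqP => [->|_] /=; rewrite ?jA // -orbA.
exists K13; first by rewrite inE.
have n12 : e q1 q2 = false by rewrite e_sym (no_triangle _ e2) // e_sym.
have n13 : e q1 q3 = false by rewrite e_sym (no_triangle _ e3) // e_sym.
have n23 : e q2 q3 = false by rewrite e_sym (no_triangle _ e3) // e_sym.
split=> //.
- rewrite cons_uniq uq andbT; apply/negP => /qA; by rewrite eqxx.
- move=> [|[|[|[|i]]]] [|[|[|[|k]]]] //= _ _;
    rewrite /adj /= ?e_irr ?e1 ?e2 ?e3 ?n12 ?n13 ?n23 //.
  all: try by rewrite e_sym ?e1 ?e2 ?e3 ?n12 ?n13 ?n23.
Qed.

Lemma bad_two_edges_single N G A : bounded N -> described N -> #|G| <= N -> kconn 2 G ->
  3 * nu G < #|G| -> A \subset G -> A != G -> bad A -> eb A (G :\: A) <= 2 ->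
  exists p, A = [set p].
Proof.
move=> bN dN GN kG ltG AG AnG bA eA.
have [/eqP/cards1P //|] := two_edge_cut bN dN GN kG AG AnG bA eA.
by rewrite leqNgt ltG.
Qed.

(** The vertices v, u, w, p2, j, p1 form a hexagon in this order, and [v], [w], [j] have one
    neighbour each in [A]. It remains to identify [A]: a single vertex would close a 4-cycle, and a
    triple join here has single vertices as parts, which makes it a claw. *)
Lemma triple_join_hexagon_oriented N G u v w j p1 p2 A (D := [set u; v; w]) (R := G :\: D) :
  bounded N -> described N -> #|G| <= N -> kconn 2 G -> 3 * nu G < #|G| ->
  D \subset G -> uniq [:: u; v; w] -> e u v -> e u w ->
  {in R, forall z, e u z = false} -> dg R v <= 2 -> dg R w <= 2 ->
  j \in R -> R :\ j = [set p1; p2] :|: A -> bad A -> p1 != p2 -> p1 \notin A -> p2 \notin A ->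
  e j p1 -> e j p2 -> dg A j = 1 -> dg A p1 = 0 -> dg A p2 = 0 ->
  e p1 v -> e p1 w = false -> e p2 w -> e p2 v = false ->
  0 < eb A D <= 2 -> eb A (G :\: A) = (eb A D).+1 -> block G.
Proof.
move=> bN dN GN kG ltG DG uniqD euv euw uR dv dw jR eR bA p12 p1A p2A ejp1 ejp2 djA dA1 dA2
  p1v p1w p2w p2v /andP[eA0 eA2] eAG.
have [uv uw vw] : [/\ u != v, u != w & v != w].
  by move: uniqD; rewrite /= !inE negb_or => /and3P[/andP[-> ->] ->].
have RG : R \subset G by apply: subsetDl.
have inR z : (z \in R) = [|| z == j, z == p1, z == p2 | z \in A].
  case: (eqVneq z j) => [->|zj] //=; have /setP/(_ z) := eR.
  by rewrite in_setD1 zj /= => ->; rewrite !inE orbA.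
have jA : j \notin A.
  by apply/negP => jA; have /setP/(_ j) := eR; rewrite in_setD1 eqxx in_setU jA orbT.
have jp1 : j != p1.
  by apply/negP => /eqP jp; have /setP/(_ j) := eR; rewrite in_setD1 eqxx !inE jp eqxx.
have jp2 : j != p2.
  by apply/negP => /eqP jp; have /setP/(_ j) := eR; rewrite in_setD1 eqxx !inE jp eqxx orbT.
have [p1R p2R] : p1 \in R /\ p2 \in R by rewrite !inR !eqxx !orbT.
have AR : A \subset R by apply/subsetP => z zA; rewrite inR zA !orbT.
have AG := subset_trans AR RG.
have notD z : z \in R -> [/\ z != u, z != v & z != w].
  by rewrite !inE !negb_or => /andP[/andP[/andP[-> ->] ->]].
have AnG : A != G.
  by apply: contraNneq jA => ->; apply: (subsetP RG).
have [k0 [a3A ea3]] := dg_eq1 djA.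
have eAD : eb A D = dg A v + dg A w.
  have dAu : dg A u = 0.
    apply/eqP; rewrite -eb_set1l; apply/eb_eq0 => x y; rewrite inE => /eqP-> yA.
    by apply: uR; apply: (subsetP AR).
  rewrite ebC /D (eb_D1l _ (x := u)) ?inE ?eqxx // dAu add0n.
  have -> : [set u; v; w] :\ u = [set v; w].
    by apply/setP => z; rewrite !inE; case: eqP => // ->; rewrite (negbTE uv) (negbTE uw).
  rewrite ebUl ?eb_set1l // disjoints_subset sub1set !inE //.
have dAv : dg A v <= 1.
  have := dgS v (_ : [set p1] :|: A \subset R).
  rewrite subUset sub1set p1R AR => /(_ isT); rewrite dgU //; last first.
    by rewrite disjoints_subset sub1set inE.
  by rewrite dg_set1 e_sym p1v; move: dv; move: (dg _ _) (dg _ _) => s t; clear; lia.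
have dAw : dg A w <= 1.
  have := dgS w (_ : [set p2] :|: A \subset R).
  rewrite subUset sub1set p2R AR => /(_ isT); rewrite dgU //; last first.
    by rewrite disjoints_subset sub1set inE.
  by rewrite dg_set1 e_sym p2w; move: dw; move: (dg _ _) (dg _ _) => s t; clear; lia.
(* Otherwise [z] closes the 4-cycle j p1 v z or j p2 w z. *)
have sq z : z \in A -> e j z -> (e v z || e w z) = false.
  move=> zA ejz; apply/negP => /orP[ez|ez].
    have := no_square (x := j) (y := p1) (z := v) (w := z).
    rewrite ejp1 p1v ez (e_sym z) ejz => /(_ isT isT isT isT).
    have [_ -> _] := notD _ jR => /(_ isT) p1z.
    by move: p1A; rewrite p1z zA.
  have := no_square (x := j) (y := p2) (z := w) (w := z).
  rewrite ejp2 p2w ez (e_sym z) ejz => /(_ isT isT isT isT).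
  have [_ _ ->] := notD _ jR => /(_ isT) p2z.
  by move: p2A; rewrite p2z zA.
have notsingle z : A = [set z] -> False.
  move=> eAz; have zA : z \in A by rewrite eAz inE.
  have ejz : e j z by move: djA; rewrite eAz dg_set1; case: (e j z).
  have := sq z zA ejz; have := eA0; rewrite eAD eAz !dg_set1.
  by case: (e v z); case: (e w z).
have eA : eb A D = 2.
  apply/eqP; rewrite eqn_leq eA2 /= ltnNge; apply/negP => eA1.
  have [|z /notsingle//] := bad_two_edges_single bN dN GN kG ltG AG AnG bA.
  by rewrite eAG; move: eA1; move: (eb _ _) => s; clear; lia.
have [dAv1 dAw1] : dg A v = 1 /\ dg A w = 1.
  by move: eA dAv dAw; rewrite eAD; move: (dg _ _) (dg _ _) => s t; clear; lia.
have [a1 [a1A ea1]] := dg_eq1 dAv1; have [a2 [a2A ea2]] := dg_eq1 dAw1.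
have ltAN : #|A| < N.
  by apply: leq_trans GN; apply: proper_card; rewrite properEneq AnG.
have mA : modelled (K13 :: blocks) A.
  have [[A1|tj|[_ [s sA [g gB rg]]]] _] := dN A ltAN bA.
  - by have /eqP/cards1P[z /notsingle] := A1.
  - clear notsingle; move: tj.
  2: by exists s => //; exists g => //; rewrite inE gB orbT.
  move=> [j' [B1 [B2 [B3 [j'A eB bs ds [djs es]]]]]].
  have [part sum] := triple_join_parts kG AG j'A eB bs ds es.
  have [b1 b2 b3] := bs; have [d12 d13 d23] := ds; have [dj1 dj2 dj3] := djs.
  have [B1A f1 g1] := part _ (mem_head _ _).
  have [B2A f2 g2] : [/\ B2 \subset A :\ j', eb B2 (G :\: B2) = (eb B2 (G :\: A)).+1 &
      0 < eb B2 (G :\: A)] by apply: part; rewrite !inE eqxx orbT.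
  have [B3A f3 g3] : [/\ B3 \subset A :\ j', eb B3 (G :\: B3) = (eb B3 (G :\: A)).+1 &
      0 < eb B3 (G :\: A)] by apply: part; rewrite !inE eqxx !orbT.
  (* Three edges leave [A], at least one from each part, so each part has exactly one. *)
  have [l1 l2 l3] : [/\ eb B1 (G :\: A) <= 1, eb B2 (G :\: A) <= 1 & eb B3 (G :\: A) <= 1].
    move: sum g1 g2 g3; rewrite eAG eA.
    move: (dg _ _) (eb _ _) (eb _ _) (eb _ _) => p q r s; clear => h1 h2 h3 h4.
    by split; lia.
  have single B : B \subset A :\ j' -> bad B -> eb B (G :\: B) = (eb B (G :\: A)).+1 ->
      eb B (G :\: A) <= 1 -> exists p, B = [set p].
    move=> BA bB fB lB; have BG := subset_trans BA (subset_trans (subsetDl _ _) AG).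
    apply: (bad_two_edges_single bN dN GN kG ltG BG _ bB); last by rewrite fB.
    apply: contraTneq BA => ->; apply/negP => /subsetP/(_ j' (subsetP AG _ j'A)).
    by rewrite !inE eqxx.
  have [q1 eq1] := single _ B1A b1 f1 l1.
  have [q2 eq2] := single _ B2A b2 f2 l2.
  have [q3 eq3] := single _ B3A b3 f3 l3.
  rewrite eq1 eq2 eq3 in eB dj1 dj2 dj3 d12 d13 d23.
  have [s sA [g gK rg]] : modelled [:: K13] A.
    apply: (claw_modelled eB j'A).
      move: d12 d13 d23; rewrite !disjoints_subset !sub1set !inE => q12 q13 q23.
      by rewrite /= !inE negb_or q12 q13 q23.
    by move: dj1 dj2 dj3; rewrite !dg_set1; case: (e j' q1); case: (e j' q2); case: (e j' q3).
  by exists s => //; exists g => //; move: gK; rewrite !inE => ->.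
have notA z : z \notin R -> z \notin A by apply: contraNN => /(subsetP AR).
have [uR' vR wR] : [/\ u \notin R, v \notin R & w \notin R] by rewrite !inE !eqxx !orbT.
have hex : hexagon A v w j u p1 p2 a1 a2 k0.
  have [ju jv jw] := notD _ jR; have [pu pv pw] := notD _ p1R; have [qu qv qw] := notD _ p2R.
  split.
  - rewrite /= !inE !negb_or p12 jp1 jp2 ju vw (eq_sym v) jv (eq_sym v) uv !(eq_sym v) pv qv.
    by rewrite !(eq_sym w) jw uw pw qw !(eq_sym u) pu qu.
  - move=> z zA; rewrite !inE !negb_or.
    have zR := subsetP AR _ zA; have [-> -> ->] := notD _ zR.
    by rewrite !(contraTneq _ zA) // => ->.
  - by split; split=> //; rewrite e_sym.
  - by [].
  - move=> z zA; split; first by rewrite ea1 ?ea2 ?ea3.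
    split; first by apply: uR; apply: (subsetP AR).
      by move/eqP: dA1; rewrite -eb_set1l => /eb_eq0 -> //; rewrite inE.
    by move/eqP: dA2; rewrite -eb_set1l => /eb_eq0 -> //; rewrite inE.
have := block_hex mA hex.
have -> : A :|: [set z in [:: v; w; j; u; p1; p2]] = G.
  apply/setP => z; rewrite !inE; have := inR z; rewrite !inE.
  have [/orP[/orP[]|]/eqP->|zD] := boolP ((z == u) || (z == v) || (z == w)).
  - by rewrite eqxx !orbT (subsetP DG) // !inE eqxx.
  - by rewrite eqxx !orbT (subsetP DG) // !inE eqxx orbT.
  - by rewrite eqxx !orbT (subsetP DG) // !inE eqxx !orbT.
  rewrite /= => ->; move: zD; rewrite !negb_or => /andP[/andP[/negbTE-> /negbTE->] /negbTE->].
  by rewrite /=; case: (z == j); case: (z == p1); case: (z == p2); case: (z \in A).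
by case=> //; rewrite leqNgt ltG.
Qed.

(** The parts with one edge to [D] have two edges in all, so they are single vertices. Both are
    adjacent to [j], hence not to the same end of the path: one sees [v], the other [w], and
    renaming gives the oriented case. *)
Lemma triple_join_hexagon N G u v w j A1 A2 A3 (D := [set u; v; w]) (R := G :\: D) :
  bounded N -> described N -> #|G| <= N -> kconn 2 G -> 3 * nu G < #|G| ->
  D \subset G -> uniq [:: u; v; w] -> e u v -> e u w ->
  {in R, forall z, e u z = false} -> dg R v <= 2 -> dg R w <= 2 ->
  j \in R -> R :\ j = A1 :|: A2 :|: A3 -> [/\ bad A1, bad A2 & bad A3] ->
  [/\ [disjoint A1 & A2], [disjoint A1 & A3] & [disjoint A2 & A3]] ->
  [/\ dg A1 j = 1, dg A2 j = 1 & dg A3 j = 1] ->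
  [/\ eb A1 (R :\: A1) = 1, eb A2 (R :\: A2) = 1 & eb A3 (R :\: A3) = 1] ->
  eb A1 D = 1 -> eb A2 D = 1 -> eb A3 D <= 2 -> block G.
Proof.
move=> bN dN GN kG ltG DG uniqD euv euw uR dv dw jR eR bads ds djs es h1 h2 h3.
have [uv uw vw] : [/\ u != v, u != w & v != w].
  by move: uniqD; rewrite /= !inE negb_or => /and3P[/andP[-> ->] ->].
have RG : R \subset G by apply: subsetDl.
have [part _] := triple_join_parts kG RG jR eR bads ds es.
have GR : G :\: R = D by rewrite setDDr setDv set0U (setIidPr DG).
rewrite GR in part.
have [b1 b2 b3] := bads; have [d12 d13 d23] := ds; have [dj1 dj2 dj3] := djs.
have [e1 e2 e3] := es.
have [A1R f1 _] := part _ (mem_head _ _).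
have [A2R f2 _] : [/\ A2 \subset R :\ j, eb A2 (G :\: A2) = (eb A2 D).+1 & 0 < eb A2 D].
  by apply: part; rewrite !inE eqxx orbT.
have [A3R f3 g3] : [/\ A3 \subset R :\ j, eb A3 (G :\: A3) = (eb A3 D).+1 & 0 < eb A3 D].
  by apply: part; rewrite !inE eqxx !orbT.
have single A : A \subset R :\ j -> bad A -> eb A (G :\: A) = (eb A D).+1 -> eb A D = 1 ->
    exists p, A = [set p].
  move=> AR bA fA lA; have AG := subset_trans AR (subset_trans (subsetDl _ _) RG).
  apply: (bad_two_edges_single bN dN GN kG ltG AG _ bA); last by rewrite fA lA.
  apply: contraTneq AR => ->; apply/negP => /subsetP/(_ j (subsetP RG _ jR)).
  by rewrite !inE eqxx.
have [p1 ep1] := single _ A1R b1 f1 h1; have [p2 ep2] := single _ A2R b2 f2 h2.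
move: A1R A2R; rewrite ep1 ep2 !sub1set => p1R p2R.
have jA3 : j \notin A3 by apply/negP => /(subsetP A3R); rewrite !inE eqxx.
have noA3 p : p \in R :\ j -> p \notin A3 -> e p j -> eb [set p] (R :\: [set p]) = 1 -> dg A3 p = 0.
  move=> pR pA3 epj ep; have jA : [disjoint [set j] & A3].
    by rewrite disjoints_subset sub1set inE.
  have sub : [set j] :|: A3 \subset R :\: [set p].
    rewrite subUset sub1set; apply/andP; split.
      by move: pR; rewrite !in_setD1 jR andbT eq_sym => /andP[].
    apply/subsetP => z zA; rewrite in_setD1 (subsetP (subsetDl R [set j])) ?(subsetP A3R) //.
    by rewrite andbT; apply: contraNneq pA3 => <-.
  have := dgS p sub; rewrite (dgU) // dg_set1 epj.
  by rewrite eb_set1l in ep; rewrite ep; case: (dg _ _).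
rewrite ep1 ep2 !eb_set1l !dg_set3 // in h1 h2.
rewrite ep1 ep2 !dg_set1 in dj1 dj2.
have ejp1 : e j p1 by case: (e j p1) dj1.
have ejp2 : e j p2 by case: (e j p2) dj2.
have p1A3 : p1 \notin A3 by move: d13; rewrite ep1 disjoints_subset sub1set inE.
have p2A3 : p2 \notin A3 by move: d23; rewrite ep2 disjoints_subset sub1set inE.
have p12 : p1 != p2 by move: d12; rewrite ep1 ep2 disjoints_subset sub1set !inE.
have n1 : dg A3 p1 = 0 by apply: noA3; rewrite // 1?e_sym // -ep1.
have n2 : dg A3 p2 = 0 by apply: noA3; rewrite // 1?e_sym // -ep2.
have up1 : e p1 u = false by rewrite e_sym uR //; move: p1R; rewrite in_setD1 => /andP[].
have up2 : e p2 u = false by rewrite e_sym uR //; move: p2R; rewrite in_setD1 => /andP[].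
rewrite up1 up2 !add0n in h1 h2.
have jD z : z \in D -> j != z.
  by move=> zD; apply: contraTneq jR => ->; rewrite inE zD.
have sq z : z \in D -> e p1 z && e p2 z = false.
  move=> zD; apply/negP => /andP[z1 z2].
  have := no_square ejp1 z1; move=> /(_ p2); rewrite (e_sym z) z2 (e_sym p2) ejp2.
  by move=> /(_ isT isT (jD _ zD))/eqP; rewrite (negbTE p12).
have sqv : e p1 v && e p2 v = false by apply: sq; rewrite !inE eqxx orbT.
have sqw : e p1 w && e p2 w = false by apply: sq; rewrite !inE eqxx orbT.
have eR' : R :\ j = [set p1; p2] :|: A3 by rewrite eR ep1 ep2.
have range : 0 < eb A3 D <= 2 by rewrite g3.
have [p1v|p1v] := boolP (e p1 v).
  apply: (triple_join_hexagon_oriented (u := u) (v := v) (w := w) bN dN GN kG ltG DG uniqD euv euw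
    uR dv dw jR eR' b3 p12) => //.
  - by move: h1; rewrite p1v; case: (e p1 w).
  - by move: h1 h2 sqv sqw; rewrite p1v; case: (e p1 w); case: (e p2 v); case: (e p2 w).
  - by move: sqv; rewrite p1v.
have DE : [set u; w; v] = D by rewrite setUAC.
have p1w : e p1 w by move: h1; rewrite (negbTE p1v); case: (e p1 w).
apply: (triple_join_hexagon_oriented (u := u) (v := w) (w := v) (p1 := p1) (p2 := p2) (j := j) (A := A3)
  bN dN GN kG ltG); rewrite ?DE //.
- by rewrite /= !inE negb_or uw uv eq_sym vw.
- exact: negbTE.
- by move: h2 sqw; rewrite p1w; case: (e p2 v); case: (e p2 w).
- by move: sqw; rewrite p1w.
Qed.

(* Remove the closed neighbourhood of a vertex [u] of degree 2, at the cost of three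
   vertices for one edge. At most four edges leave it, and a bad component meets
   at least three of them by [two_edge_cut]; so there is only one, and it is
   everything that remains. *)
Lemma bridgeless_case N G : bounded N -> described N -> #|G| <= N -> kconn 2 G -> noncubic G ->
  #|G| <= 3 * nu G + 1 /\ (#|G| <= 3 * nu G \/ shape G).
Proof.
move=> bN dN GN kG ncG.
have [G1|G2] := leqP #|G| 1.
  split; first by apply: leq_trans G1 _; rewrite leq_addl.
  right; constructor 1; apply/eqP; rewrite eqn_leq G1 card_gt0; by case/andP: kG.
have [u uG du2] := exists_inP ncG.
have du : dg G u = 2 by apply/eqP; rewrite eqn_leq du2; apply: (kconn_dg kG).
have /eqP/cards2P[v [w [vw eN]]] := du.
have inN z : (z \in G) && e u z = (z == v) || (z == w).
  by have /setP/(_ z) := eN; rewrite !inE.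
have /andP[vG euv] : (v \in G) && e u v by rewrite inN eqxx.
have /andP[wG euw] : (w \in G) && e u w by rewrite inN eqxx orbT.
have uv : u != v by apply: contraTneq euv => ->; rewrite e_irr.
have uw : u != w by apply: contraTneq euw => ->; rewrite e_irr.
have uniqD : uniq [:: u; v; w] by rewrite /= !inE negb_or uv uw vw.
pose D := [set u; v; w]; pose R := G :\: D.
have DG : D \subset G by rewrite !subUset !sub1set uG vG wG.
have D0 : D != set0 by apply/set0Pn; exists u; rewrite !inE eqxx.
have cD : #|D| = 3 by rewrite /D setUC cardsU1 cards2 !inE negb_or !(eq_sym w) uv uw vw.
have cG := cards_split DG; rewrite cD -/R in cG.
have ltR : #|R| < N by apply: leq_trans GN; rewrite cG; clear; lia.
have uR : {in R, forall z, e u z = false}.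
  move=> z; rewrite !inE !negb_or => /andP[/andP[/andP[_ zv] zw] zG].
  by have := inN z; rewrite zG (negbTE zv) (negbTE zw).
have RG : R \subset G by apply: subsetDl.
have deg2 x : x \in D -> e u x -> dg R x <= 2.
  move=> xD eux; have := dg_le3 (R :|: [set u]) x.
  rewrite dgU // ?dg_set1 1?e_sym ?eux ?addn1 // disjoint_sym disjoints_subset sub1set.
  by rewrite !inE eqxx.
have dv : dg R v <= 2 by apply: deg2 => //; rewrite !inE eqxx orbT.
have dw : dg R w <= 2 by apply: deg2 => //; rewrite !inE eqxx orbT.
have nuR : (nu R).+1 <= nu G.
  apply: leq_ltn_trans (nu_peel uG vG euv).
  apply: nuS => //; apply/subsetP => z zR; rewrite inE (subsetP RG) // andbT !inE uR // orbF.
  by move: zR; rewrite !inE !negb_or => /andP[/andP[/andP[]]].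
have ebD A : A \subset R -> eb A D = dg A v + dg A w.
  move=> AR; have dAu : dg A u = 0.
    apply/eqP; rewrite -eb_set1l; apply/eb_eq0 => x y; rewrite inE => /eqP-> yA.
    by apply: uR; apply: (subsetP AR).
  rewrite ebC /D (eb_D1l _ (x := u)) ?inE ?eqxx // dAu add0n.
  have -> : [set u; v; w] :\ u = [set v; w].
    by apply/setP => z; rewrite !inE; case: eqP => // ->; rewrite (negbTE uv) (negbTE uw).
  by rewrite ebUl ?eb_set1l // disjoints_subset sub1set !inE.
have [le1 le2] := delete_bound bN (ltn0Sn 1) kG DG D0 ltR.
rewrite -/R in le1 le2.
have eRD : eb R D <= 4.
  by rewrite ebD //; move: dv dw; move: (dg _ _) (dg _ _) => s t; clear; lia.
have [ltG|ltG] := leqP #|G| (3 * nu G).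
  by split; [apply: leq_trans ltG (leq_addr _ _) | left].
have kG1 : kconn 1 G by apply: kconnW kG.
have no_common c : c \in R -> e v c && e w c = false.
  move=> cR; apply/negP => /andP[vc wc].
  have := no_square euv vc; move=> /(_ w); rewrite (e_sym c) wc (e_sym w) euw.
  move=> /(_ isT isT); have uc : u != c.
    by apply: contraTneq cR => <-; rewrite !inE eqxx.
  by move=> /(_ uc)/eqP; rewrite (negbTE vw).
have single_eb c : c \in R -> eb [set c] D <= 1.
  move=> cR; rewrite ebD ?sub1set // !dg_set1.
  by have := no_common c cR; case: (e v c); case: (e w c).
(* With only two edges to [D], [A] would be a single vertex adjacent to both [v] and [w], closing a
   4-cycle with [u]. *)
have ge3 A : A \in badc R -> 3 <= eb A D.
  move=> bA; have [cA AG AnG] := badc_proper DG D0 bA.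
  rewrite ltnNge; apply/negP => eA2.
  have [|c eA] := bad_two_edges_single bN dN GN kG ltG AG AnG (badc_bad kG1 DG D0 bA).
    by rewrite (eb_comp DG cA).
  have /compsP[AR _ _] := cA.
  have cR : c \in R by apply: (subsetP AR); rewrite eA inE.
  have := comp_eb kG DG D0 cA; have := single_eb c cR; rewrite -eA.
  by move: (eb _ _) => s; clear; lia.
have bs := badc_sub R.
have le3 : #|badc R| * 3 <= 4.
  apply: leq_trans eRD; apply: leq_trans (ebSl D (cover_comps bs)).
  rewrite -(sum_eb_comps _ bs) -sum_nat_const; apply: leq_sum => A; exact: ge3.
split.
  move: cG le1 le3 nuR; clear; move: #|_| #|_| #|_| (nu _) (nu _) => p q r s t; lia.
right; have /cards1P[A eA] : #|badc R| == 1.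
  move: cG le1 le3 nuR ltG; clear; move: #|_| #|_| #|_| (nu _) (nu _) => p q r s t; lia.
have bA : A \in badc R by rewrite eA inE.
have RA : R = A.
  have <- : cover (badc R) = A by rewrite eA /cover big_set1.
  apply: (rest_empty kG DG D0 bs).
  have -> : cover (badc R) = A by rewrite eA /cover big_set1.
  have := ge3 A bA; move: eRD; rewrite -/R; move: (eb _ _) (eb _ _) => s t; clear; lia.
have bR : bad R by rewrite RA; apply: (badc_bad kG1 DG D0 bA).
have eR3 : 3 <= eb R D by rewrite {1}RA; apply: ge3.
constructor 3; split=> //.
have [[R1|tj|[_ bl]] _] := dN R ltR bR.
- have /eqP/cards1P[c eR] := R1; have cR : c \in R by rewrite eR inE.
  have := single_eb c cR; rewrite -eR; move: eR3; move: (eb _ _) => s; clear; lia.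
- have [j [A1 [A2 [A3 [jR eR bads ds [djs es]]]]]] := tj.
  have [part sum] := triple_join_parts kG RG jR eR bads ds es.
  have GR : G :\: R = D by rewrite setDDr setDv set0U (setIidPr DG).
  rewrite GR in part sum.
  have [_ _ g1] := part _ (mem_head _ _).
  have [_ _ g2] : [/\ A2 \subset R :\ j, eb A2 (G :\: A2) = (eb A2 D).+1 & 0 < eb A2 D].
    by apply: part; rewrite !inE eqxx orbT.
  have [_ _ g3] : [/\ A3 \subset R :\ j, eb A3 (G :\: A3) = (eb A3 D).+1 & 0 < eb A3 D].
    by apply: part; rewrite !inE eqxx !orbT.
  have [b1 b2 b3] := bads; have [d12 d13 d23] := ds; have [dj1 dj2 dj3] := djs.
  have [e1 e2 e3] := es.
  have d21 : [disjoint A2 & A1] by rewrite disjoint_sym.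
  have d31 : [disjoint A3 & A1] by rewrite disjoint_sym.
  have d32 : [disjoint A3 & A2] by rewrite disjoint_sym.
  (* At most four edges reach [D], at least one from each part, so two of the parts have exactly
     one. *)
  have [[h1 h2 h3]|[h1 h3 h2]|[h2 h3 h1]] :
      [\/ [/\ eb A1 D = 1, eb A2 D = 1 & eb A3 D <= 2],
          [/\ eb A1 D = 1, eb A3 D = 1 & eb A2 D <= 2] |
          [/\ eb A2 D = 1, eb A3 D = 1 & eb A1 D <= 2]].
    move: eRD g1 g2 g3; rewrite sum; move: (dg _ _) (eb _ _) (eb _ _) (eb _ _) => p q r s.
    clear => H1 H2 H3 H4.
    have [q1|q2] := eqVneq q 1; last by constructor 1; split; lia.
    have [r1|r2] := eqVneq r 1; last by constructor 2; split; lia.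
    by constructor 3; split; lia.
  + exact: (triple_join_hexagon bN dN GN kG ltG DG uniqD euv euw uR dv dw jR eR).
  + have eR' : R :\ j = A1 :|: A3 :|: A2 by rewrite setUAC.
    exact: (triple_join_hexagon bN dN GN kG ltG DG uniqD euv euw uR dv dw jR eR').
  + have eR' : R :\ j = A2 :|: A3 :|: A1 by rewrite setUC setUA.
    exact: (triple_join_hexagon bN dN GN kG ltG DG uniqD euv euw uR dv dw jR eR').
have [v0 w0] : 0 < dg R v /\ 0 < dg R w.
  move: eR3 dv dw; rewrite ebD //; move: (dg _ _) (dg _ _) => s t; clear; lia.
have [a [b tv]] := dg_two_ends v0 dv; have [c [d tw]] := dg_two_ends w0 dw.
have [uR' vR wR] : [/\ u \notin R, v \notin R & w \notin R] by rewrite !inE !eqxx !orbT.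
have := block_path bl uR' vR wR vw euv euw uR tv tw.
have -> : R :|: [set u; v; w] = G by rewrite setUC setUD_id.
by case=> //; rewrite leqNgt ltG.
Qed.

(** * The induction and the cubic case *)

(** The bound and the description are proved together, since [two_edge_cut] at size N relies on both
    below N. *)
Lemma bounded_described N : bounded N /\ described N.
Proof.
elim: N => [|N [bN dN]]; first by split.
have step G : #|G| <= N -> kconn 1 G -> noncubic G ->
    #|G| <= 3 * nu G + 1 /\ (#|G| <= 3 * nu G \/ shape G).
  move=> GN kG ncG; have [k2|k2] := boolP (kconn 2 G); first exact: (bridgeless_case bN dN).
  have [h1 h2] := bridge_case bN GN kG k2; split=> //.
  by case: h2 => [|tj]; [left | right; constructor 2].
split=> [G GN kG ncG|G GN bG]; first by have [] := step G GN kG ncG.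
have /and3P[kG ncG ltG] := bG; have [leG [|sG]] := step G GN kG ncG.
  by rewrite leqNgt ltG.
by split=> // k2; apply: (bad_deletable2 bN dN).
Qed.

Lemma kconn_setT : connected_graph e -> kconn 1 [set: T].
Proof.
move=> con; apply/kconnP; split; first by apply/set0Pn; exists x0; rewrite inE.
move=> A _ /set0Pn[a aA] AnT; rewrite lt0n; apply: contraNN AnT => /eb_eq0 eA.
apply/eqP/setP => z; rewrite inE; have /connectP[p pp ->] := con a z.
elim: p a aA pp => //= b p IH a aA /andP[eab pp]; apply: IH pp.
by apply: contraT => bA; have := eA a b aA; rewrite eab !inE bA => /(_ isT).
Qed.

(** Three edges leave [x0] and a bad component takes two, so if the bound fails, the rest is one bad
    graph. It is no triple join: two parts would be single vertices, both adjacent to [j] and [x0],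
    a 4-cycle. So it is a block, and [x0] is the added vertex. *)
Lemma cubic_case N : bounded N -> described N -> #|T| <= N -> kconn 2 [set: T] ->
  (forall x, dg [set: T] x = 3) ->
  [\/ #|T| - 1 <= 3 * nu [set: T], graph_iso e H1 | graph_iso e H2].
Proof.
rewrite -cardsT => bN dN TN kT d3; set G := [set: T] in TN kT d3 *.
have DG : [set x0] \subset G by apply: subsetT.
have D0 : [set x0] != set0 by apply/set0Pn; exists x0; rewrite inE.
pose R := G :\: [set x0]; have RG : R \subset G by apply: subsetDl.
have cG := cards_split DG; rewrite cards1 -/R in cG.
have ltR : #|R| < N by apply: leq_trans TN; rewrite cG add1n.
have eRD : eb R [set x0] = 3 by rewrite (eb_set1r) dgD1.
have [le1 le2] := delete_bound bN (ltn0Sn 1) kT DG D0 ltR.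
rewrite -/R in le1 le2; have leRG : nu R <= nu G by apply: nuS.
have [b0|b1] := posnP #|badc R|.
  constructor 1; rewrite cG; move: le1 leRG; rewrite b0; move: #|_| (nu _) (nu _) => s t r.
  clear; lia.
have [ltG|ltG] := leqP #|G| (3 * nu G).
  by constructor 1; apply: leq_trans (leq_subr _ _) ltG.
have /cards1P[A eA] : #|badc R| == 1.
  by move: le2; rewrite eRD; move: b1; move: #|_| => s; clear; lia.
have kT1 : kconn 1 G by apply: kconnW kT.
have bA : A \in badc R by rewrite eA inE.
have cover_A : cover (badc R) = A by rewrite eA /cover big_set1.
have RA : R = A.
  rewrite -cover_A; apply: (rest_empty kT DG D0 (badc_sub R)).
  rewrite cover_A -/R eRD; have [cA _ _] := badc_proper DG D0 bA.
  by have := comp_eb kT DG D0 cA; move: (eb _ _) => s; clear; lia.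
have bR : bad R by rewrite RA; apply: (badc_bad kT1 DG D0 bA).
have GR : G :\: R = [set x0] by rewrite setDDr setDv set0U (setIidPr DG).
have [[R1|tj|[_ bl]] _] := dN R ltR bR.
- have := dg_le3 R x0; have : dg R x0 <= #|R|.
    by apply: subset_leq_card; apply/subsetP => y; rewrite inE => /andP[].
  by rewrite -(eb_set1r) eRD R1.
- have [j [A1 [A2 [A3 [jR eR bads ds [djs es]]]]]] := tj.
  have [part sum] := triple_join_parts kT RG jR eR bads ds es.
  rewrite GR eRD in part sum.
  have [A1R f1 g1] := part _ (mem_head _ _).
  have [A2R f2 g2] : [/\ A2 \subset R :\ j, eb A2 (G :\: A2) = (eb A2 [set x0]).+1 &
      0 < eb A2 [set x0]] by apply: part; rewrite !inE eqxx orbT.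
  have [_ _ g3] : [/\ A3 \subset R :\ j, eb A3 (G :\: A3) = (eb A3 [set x0]).+1 &
      0 < eb A3 [set x0]] by apply: part; rewrite !inE eqxx !orbT.
  have [b1' b2' _] := bads; have [d12 _ _] := ds; have [dj1 dj2 _] := djs.
  have [l1 l2] : eb A1 [set x0] = 1 /\ eb A2 [set x0] = 1.
    move: sum g1 g2 g3; move: (dg _ _) (eb _ _) (eb _ _) (eb _ _) => p q r s.
    by clear => h0 h1 h2 h3; split; lia.
  have single B : B \subset R :\ j -> bad B -> eb B (G :\: B) = (eb B [set x0]).+1 ->
      eb B [set x0] = 1 -> exists p, B = [set p].
    move=> BR bB fB lB; apply: (bad_two_edges_single bN dN TN kT ltG (subsetT _) _ bB).
      apply: contraTneq BR => ->; apply/negP => /subsetP/(_ j (in_setT _)).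
      by rewrite !inE eqxx.
    by rewrite fB lB.
  have [p1 ep1] := single _ A1R b1' f1 l1; have [p2 ep2] := single _ A2R b2' f2 l2.
  rewrite ep1 ep2 !dg_set1 ?(eb_set1r) ?dg_set1 in dj1 dj2 l1 l2 d12.
  have jx : j != x0 by move: jR; rewrite !inE => /andP[].
  have p12 : p1 = p2.
    apply: (no_square (x := j) (z := x0)) => //.
    + by case: (e j p1) dj1.
    + by rewrite e_sym; case: (e x0 p1) l1.
    + by case: (e x0 p2) l2.
    + by rewrite e_sym; case: (e j p2) dj2.
  by move: d12; rewrite p12 disjoints_subset sub1set !inE eqxx.
have d3x := d3 x0; pose s := enum [set y in G | e x0 y].
have ss : size s = 3 by rewrite -cardE.
have us : uniq s by apply: enum_uniq.
have ms z : e x0 z = (z \in s) by rewrite mem_enum !inE.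
case: s ss us ms => [|a [|b [|c []]]] // _ us ms.
have RE z : (z \in R) = (z != x0) by rewrite !inE andbT.
by have := block_claw bl RE us ms; rewrite -cardsT.
Qed.

End SubcubicGraphs.

Theorem theorem1 (T : finType) (e : rel T)
  (e_sym : symmetric e) (e_irr : irreflexive e)
  (Hconn : connected_graph e) (Hdeg : max_degree_le e 3) (Hgirth : girth_ge5 e)
  (HnotH1 : ~ graph_iso e H1) (HnotH2 : ~ graph_iso e H2) :
  (#|T| - 1 <= 3 * nu_ur e)%N.
Proof.
(* The empty graph counts as connected. Otherwise [x0] serves both as the default of [nth] and as
   the vertex deleted in [cubic_case]. *)
have [T0|/card_gt0P[x0 _]] := posnP #|T|; first by rewrite T0.
have [bN dN] := bounded_described x0 e_sym e_irr Hdeg Hgirth #|T|.+1.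
have TN : #|[set: T]| <= #|T|.+1 by rewrite cardsT leqnSn.
have TN' : #|[set: T]| < #|T|.+1 by rewrite cardsT.
have kT := kconn_setT x0 Hconn.
rewrite -nu_setT leq_subLR addnC.
have [k2|nk2] := boolP (kconn e 2 [set: T]); last first.
  by have [+ _] := bridge_case e_sym e_irr Hdeg bN TN kT nk2; rewrite cardsT.
have [nc|c] := boolP (noncubic e [set: T]).
  by have := bN _ TN' kT nc; rewrite cardsT.
have d3 x : dg e [set: T] x = 3.
  apply/eqP; rewrite eqn_leq dg_le3 //= ltnNge; apply: contraNN c => d2.
  by apply/exists_inP; exists x; rewrite ?inE.
have [||] // := cubic_case e_sym e_irr Hdeg Hgirth bN dN (leqnSn _) k2 d3.
by rewrite leq_subLR addnC.
Qed.
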